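(* (In ZFC.) Let $n\ge1$ be a natural number. If $\kappa$ is an $n$-subtle cardinal, then for some regular $\lambda$ with $V_\lambda$ an elementary substructure of $V_\kappa$, there is $R\subset\lambda$ such that $(V_\lambda,\in,R)$ satisfies A0–A2, A6 and B7a($n$). Alternatively, $R$ can be chosen (as a binary relation) so that $(V_\lambda,\in,R)$ satisfies B1–B8 restricted to levels of reflectiveness at most $n$. Moreover, the $n$-reflective (respectively, weakly $n$-reflective) cardinals can be chosen to be $(n-1)$-ineffable (if $n>1$) and fully indescribable in $V_\lambda$. All axioms and notions are listed in the context.
   Context: For an ordinal $\kappa$ and $k\geq 1$, $f:[\kappa]^k\to P(\kappa)$ is regressive if $f(x)\subset\min(x)$ for all $x$; $H\subset\kappa$ is $f$-homogeneous if $f(x)\cap\min(x\cup y)=f(y)\cap\min(x\cup y)$ for all $x,y\in[H]^k$. $\kappa$ is $k$-subtle if for every closed unbounded $C\subset\kappa$ and regressive $f:[\kappa]^k\to P(\kappa)$ there is an $f$-homogeneous $(k+1)$-element subset of $C$. $\kappa$ is $k$-ineffable if every regressive $f:[\kappa]^k\to P(\kappa)$ has a stationary $f$-homogeneous set $H\subset \kappa$. First set of axioms (unary $R$; $R(a)$ is read ''$a$ is weakly $n$-reflective''): A0. ZFC. A1. $\forall x \exists y \forall z\,(z \in y \Leftrightarrow z \in x \wedge R(z))$. A2. $R(a)\Rightarrow a$ is an ordinal. A6. (Schema, for every formula $\psi$ of the language with $R$, $\kappa$ not free in $\psi$) $\exists\kappa\in R\ \forall s\in V_\kappa(\psi(s)\Leftrightarrow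 V_\kappa\models\psi(s))$, evaluated in $(V_\kappa,\in,R\cap V_\kappa)$. B7a($n$). An ordinal $a$ satisfies $R(a)$ iff for all $a_1,\dots,a_{n+1}$ with $R(a_i)$ and $a\le a_1<\dots<a_{n+1}$, the theory of $(V_{a_{n+1}},\in,a,a_2,\dots,a_n)$ with parameters in $V_a$ agrees with the theory of $(V_{a_{n+1}},\in,a_1,a_2,\dots,a_n)$ with parameters in $V_a$. Second set of axioms (binary $R$; $R(k,a)$ is read ''$a$ is $k$-reflective''; $R_k=\{z:R(k,z)\}$), restricted to levels $k\le n$: B1. ZFC. B2. For all $x$ there is the set $\{(y,z)\in x:R(y,z)\}$. B3. $R(y,z)\Rightarrow y,z$ are ordinals (here with $y\le n$). B4. $R(0,x)$ iff $x$ is a regular uncountable cardinal. B5. $R(k+1,a)\Rightarrow R(k,a)$ ($k<n$). B6. For limit $k$, $R(k,a)\Leftrightarrow\forall m<k\,R(m,a)$ (vacuous for levels $\leq n$). B7. For $k<n$ and ordinals $0<a<b<c$ with $R(k+1,b)$ and $R(k+1,c)$: $R(k+1,a)$ holds iff for all (codes of) formulas $\varphi$ with two free variables in the language of set theory with a predicate for $R_k$ and all $s\in V_a$, $((V_b,\in,R_k)\models\varphi(a,s))\Leftrightarrow((V_c,\in,R_k)\models\varphi(b,s))$ (with $R_k$ restricted to the respective $V_b$, $V_c$). B8. (Schema, $m$ a natural number) There is a $\Sigma_m^{V,R}$-correct $n$-reflective cardinal $\mu$, where $\mu$ is $\Sigma_m^{V,R}$-correct if for every $\varphi$ with one free variable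 of the form $m$ alternating quantifiers starting with $\exists$ followed by a bounded-quantifier formula (allowing $R$), and all $s\in V_\mu$, $(V_\mu,\in,R)\models\varphi(s)$ iff $\varphi(s)$ holds. A cardinal $\mu<\lambda$ is fully indescribable in $V_\lambda$ if for every formula $\varphi$ of set theory (without $R$) with two free variables and every $A\subset\mu$: $V_\lambda\models(\varphi(\mu,A)\Rightarrow\exists\nu<\mu\ \varphi(\nu,A\cap\nu))$. *)

(* Defs.v *)
From mathcomp Require Import all_boot.

Set Implicit Arguments.
Unset Strict Implicit.
Unset Printing Implicit Defensive.

(* [form P Q n]: first-order formulas with equality over a binary symbol
   (membership), unary symbols from [P] and binary symbols from [Q], whose free
   variables are indexed by ['I_n].  Variables are de Bruijn indices: a
   quantifier binds [ord0] of its body and shifts the others by [lift ord0]. *)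
Inductive form (P Q : Type) : nat -> Type :=
| Mem n : 'I_n -> 'I_n -> form P Q n
| Equ n : 'I_n -> 'I_n -> form P Q n
| Un n : P -> 'I_n -> form P Q n
| Bin n : Q -> 'I_n -> 'I_n -> form P Q n
| Neg n : form P Q n -> form P Q n
| And n : form P Q n -> form P Q n -> form P Q n
| Imp n : form P Q n -> form P Q n -> form P Q n
| All n : form P Q n.+1 -> form P Q n
| Ex n : form P Q n.+1 -> form P Q n.

Arguments Mem {P Q n}.
Arguments Equ {P Q n}.
Arguments Un {P Q n}.
Arguments Bin {P Q n}.

Notation form_set := (form void void).
Notation form_un := (form unit void).
Notation form_bin := (form void unit).

Inductive bounded (P Q : Type) : forall n, form P Q n -> Prop :=
| bounded_Mem n (i j : 'I_n) : bounded (Mem i j)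
| bounded_Equ n (i j : 'I_n) : bounded (Equ i j)
| bounded_Un n p (i : 'I_n) : bounded (Un p i)
| bounded_Bin n q (i j : 'I_n) : bounded (Bin q i j)
| bounded_Neg n (phi : form P Q n) : bounded phi -> bounded (Neg phi)
| bounded_And n (phi psi : form P Q n) :
    bounded phi -> bounded psi -> bounded (And phi psi)
| bounded_Imp n (phi psi : form P Q n) :
    bounded phi -> bounded psi -> bounded (Imp phi psi)
| bounded_All n (i : 'I_n) (phi : form P Q n.+1) :
    bounded phi -> bounded (All (Imp (Mem ord0 (lift ord0 i)) phi))
| bounded_Ex n (i : 'I_n) (phi : form P Q n.+1) :
    bounded phi -> bounded (Ex (And (Mem ord0 (lift ord0 i)) phi)).

(* [alternating b m phi]: [m] alternating quantifiers in front of a bounded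
   formula, the first being existential if [b] and universal otherwise. *)
Inductive alternating (P Q : Type) :
    bool -> nat -> forall n, form P Q n -> Prop :=
| alternating_0 b n (phi : form P Q n) : bounded phi -> alternating b 0 phi
| alternating_Ex m n (phi : form P Q n.+1) :
    alternating false m phi -> alternating true m.+1 (Ex phi)
| alternating_All m n (phi : form P Q n.+1) :
    alternating true m phi -> alternating false m.+1 (All phi).

Definition scons (T : Type) n (x : T) (e : 'I_n -> T) : 'I_n.+1 -> T :=
  fun i => if unlift ord0 i is Some j then e j else x.

Definition cat_env (T : Type) m n (d : 'I_m -> T) (e : 'I_n -> T) :
    'I_(m + n) -> T :=
  fun i => match split i with inl j => d j | inr j => e j end.

Definition env1 (T : Type) (x : T) : 'I_1 -> T := fun=> x.
Definition env2 (T : Type) (x y : T) : 'I_2 -> T := scons x (env1 y).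

Section Satisfaction.
Variables (T : Type) (mem : T -> T -> Prop).

(* Satisfaction in the substructure with domain [M], to which the predicates
   [p] and [q] are thereby restricted. *)
Fixpoint sat (P Q : Type) (M : T -> Prop) (p : P -> T -> Prop)
    (q : Q -> T -> T -> Prop) n (phi : form P Q n) : ('I_n -> T) -> Prop :=
  match phi in form _ _ n return ('I_n -> T) -> Prop with
  | Mem _ i j => fun e => mem (e i) (e j)
  | Equ _ i j => fun e => e i = e j
  | Un _ r i => fun e => p r (e i)
  | Bin _ r i j => fun e => q r (e i) (e j)
  | Neg _ f => fun e => ~ sat M p q f e
  | And _ f g => fun e => sat M p q f e /\ sat M p q g e
  | Imp _ f g => fun e => sat M p q f e -> sat M p q g e
  | All _ f => fun e => forall x, M x -> sat M p q f (scons x e)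
  | Ex _ f => fun e => exists x, M x /\ sat M p q f (scons x e)
  end.

Definition sat_set (M : T -> Prop) n (phi : form_set n) (e : 'I_n -> T) :=
  sat M (@of_void (T -> Prop)) (@of_void (T -> T -> Prop))
    phi e.

Definition sat_un (M R : T -> Prop) n (phi : form_un n) (e : 'I_n -> T) :=
  sat M (fun=> R) (@of_void (T -> T -> Prop)) phi e.

Definition sat_bin (M : T -> Prop) (R : T -> T -> Prop) n (phi : form_bin n)
    (e : 'I_n -> T) :=
  sat M (@of_void (T -> Prop)) (fun=> R) phi e.

(* The axioms of ZFC in the structure (M, mem).  [D] tells which binary relations
   (and, through constant extensions, which classes) are allowed in the
   separation and replacement schemas. *)
Record zfc_axioms (M : T -> Prop) (D : (T -> T -> Prop) -> Prop) : Prop := {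
  zfc_extensionality : forall x y, M x -> M y ->
    (forall z, M z -> (mem z x <-> mem z y)) -> x = y;
  zfc_foundation : forall x, M x -> (exists y, M y /\ mem y x) ->
    exists y, [/\ M y, mem y x & forall z, M z -> ~ (mem z x /\ mem z y)];
  zfc_pairing : forall x y, M x -> M y ->
    exists p, M p /\ forall z, M z -> (mem z p <-> z = x \/ z = y);
  zfc_union : forall x, M x ->
    exists u, M u /\
      forall z, M z -> (mem z u <-> exists y, [/\ M y, mem y x & mem z y]);
  zfc_powerset : forall x, M x ->
    exists p, M p /\
      forall z, M z ->
        (mem z p <-> forall w, M w -> mem w z -> mem w x);
  zfc_infinity : exists x,
    [/\ M x,
        exists z, [/\ M z, mem z x & forall w, M w -> ~ mem w z] &
        forall y, M y -> mem y x ->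
          exists s, [/\ M s, mem s x &
            forall z, M z -> (mem z s <-> mem z y \/ z = y)]];
  zfc_separation : forall A : T -> Prop, D (fun z _ => A z) ->
    forall x, M x ->
      exists y, M y /\ forall z, M z -> (mem z y <-> mem z x /\ A z);
  zfc_replacement : forall F : T -> T -> Prop, D F ->
    (forall z w w', M z -> M w -> M w' -> F z w -> F z w' -> w = w') ->
    forall x, M x ->
      exists y, M y /\
        forall w, M w -> (mem w y <-> exists z, [/\ M z, mem z x & F z w]);
  zfc_choice : forall x, M x ->
    (forall y, M y -> mem y x -> exists z, M z /\ mem z y) ->
    (forall y y' z, M y -> M y' -> M z ->
      mem y x -> mem y' x -> mem z y -> mem z y' -> y = y') ->
    exists c, M c /\ forall y, M y -> mem y x ->
      exists z, [/\ M z, mem z y, mem z c &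
        forall z', M z' -> mem z' y -> mem z' c -> z' = z]
}.

Definition definable (M : T -> Prop) (F : T -> T -> Prop) : Prop :=
  exists m (phi : form_set m.+2) (e : 'I_m -> T), (forall i, M (e i)) /\
    forall x y, M x -> M y ->
      (F x y <-> sat_set M phi (scons x (scons y e))).

Definition models_zfc (M : T -> Prop) : Prop := zfc_axioms M (definable M).

End Satisfaction.

(* The ambient set theory: a model of ZFC in which separation and replacement
   hold for every class of the metatheory.  Its natural numbers are standard,
   every subset of one of its sets is represented, and so is every function
   between its sets; hence functions between sets, subsets of [V_l] and codes of
   formulas are rendered below by functions [U -> U], predicates on [U] and
   elements of [form]. *)
Record universe := Universe {
  carrier :> Type;
  elem : carrier -> carrier -> Prop;
  universe_zfc : zfc_axioms elem (fun=> True) (fun=> True)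
}.

Notation "x ∈ y" := (elem x y) (at level 70, no associativity).

Section SetTheory.
Variable U : universe.
Implicit Types (x y z a b c l mu nu kappa : U).

Definition subset x y : Prop := forall z, z ∈ x -> z ∈ y.

Definition ordinal a : Prop :=
  (forall x, x ∈ a -> subset x a) /\
  (forall x y, x ∈ a -> y ∈ x -> subset y x).

Definition ole a b : Prop := a ∈ b \/ a = b.

Definition least a (A : U -> Prop) : Prop := A a /\ forall b, A b -> ole a b.

Definition limit a : Prop :=
  [/\ ordinal a, exists b, b ∈ a & forall b, b ∈ a -> exists c, c ∈ a /\ b ∈ c].

(* [x] is the von Neumann numeral of [m]. *)
Fixpoint numeral (m : nat) x : Prop :=
  match m with
  | 0 => forall z, ~ z ∈ x
  | m'.+1 => exists y, numeral m' y /\ forall z, z ∈ x <-> z ∈ y \/ z = y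
  end.

Definition infinite a : Prop := forall m x, numeral m x -> x ∈ a.

Definition cardinal a : Prop :=
  ordinal a /\
  forall b, b ∈ a ->
    ~ exists f : U -> U, (forall x, x ∈ a -> f x ∈ b) /\
        forall x y, x ∈ a -> y ∈ a -> f x = f y -> x = y.

Definition uncountable_cardinal a : Prop :=
  cardinal a /\ exists b, b ∈ a /\ infinite b.

Definition regular a : Prop :=
  [/\ cardinal a, infinite a &
      forall b (f : U -> U), b ∈ a -> (forall x, x ∈ b -> f x ∈ a) ->
        exists c, c ∈ a /\ forall x, x ∈ b -> f x ∈ c].

(* [V a x]: [x] belongs to V_a, the union of the powersets of the V_b, b < a. *)
Inductive V a x : Prop :=
| V_intro b : b ∈ a -> (forall y, y ∈ x -> V b y) -> V a x.

(* Unboundedness is cofinality with respect to [ole]: with the strict order,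
   successor ordinals would have no closed unbounded subset. *)
Definition club kappa c : Prop :=
  [/\ subset c kappa,
      forall a, a ∈ kappa -> exists b, b ∈ c /\ ole a b &
      forall a, a ∈ kappa -> limit a ->
        (forall b, b ∈ a -> exists d, [/\ d ∈ c, d ∈ a & ole b d]) -> a ∈ c].

Definition stationary kappa h : Prop :=
  subset h kappa /\ forall c, club kappa c -> exists a, a ∈ h /\ a ∈ c.

Definition has_size (m : nat) x : Prop :=
  exists e : 'I_m -> U, injective e /\ forall z, z ∈ x <-> exists i, z = e i.

(* [tuples m h] is [h]^m, the class of m-element subsets of [h]. *)
Definition tuples (m : nat) h x : Prop := subset x h /\ has_size m x.

Definition regressive (m : nat) kappa (f : U -> U) : Prop :=
  forall x a, tuples m kappa x -> least a (fun z => z ∈ x) -> subset (f x) a.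

Definition homogeneous (m : nat) (f : U -> U) h : Prop :=
  forall x y a, tuples m h x -> tuples m h y ->
    least a (fun z => z ∈ x \/ z ∈ y) ->
    forall z, z ∈ a -> (z ∈ f x <-> z ∈ f y).

Definition subtle (m : nat) kappa : Prop :=
  ordinal kappa /\
  forall c (f : U -> U), club kappa c -> regressive m kappa f ->
    exists h, tuples m.+1 c h /\ homogeneous m f h.

Definition ineffable (m : nat) kappa : Prop :=
  ordinal kappa /\
  forall f : U -> U, regressive m kappa f ->
    exists h, stationary kappa h /\ homogeneous m f h.

Definition elementary_substructure (M N : U -> Prop) : Prop :=
  (forall x, M x -> N x) /\
  forall n (phi : form_set n) (e : 'I_n -> U), (forall i, M (e i)) ->
    (sat_set (@elem U) M phi e <-> sat_set (@elem U) N phi e).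

Definition fully_indescribable l mu : Prop :=
  [/\ cardinal mu, mu ∈ l &
      forall (phi : form_set 2) A, subset A mu ->
        sat_set (@elem U) (V l) phi (env2 mu A) ->
        exists nu B, [/\ nu ∈ mu, forall z, z ∈ B <-> z ∈ A /\ z ∈ nu &
          sat_set (@elem U) (V l) phi (env2 nu B)]].

(* The axioms below are the relativizations to V_l of the axioms on R, for [l] a
   limit: absolute notions (ordinal, regular, V_a, satisfaction in V_a, ...) are
   evaluated in [U]. *)
Section WeaklyReflective.
Variables (l : U) (R : U -> Prop).

Definition A1 : Prop :=
  forall x, V l x -> exists y, V l y /\
    forall z, V l z -> (z ∈ y <-> z ∈ x /\ R z).

Definition A2 : Prop := forall a, V l a -> R a -> ordinal a.

Definition A6 : Prop :=
  forall psi : form_un 1, exists kappa, [/\ V l kappa, R kappa &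
    forall s, V kappa s ->
      (sat_un (@elem U) (V l) R psi (env1 s) <->
       sat_un (@elem U) (V kappa) R psi (env1 s))].

(* For alpha = (a_1, ..., a_(n+1)), indexed from 0, this is the tuple
   (a, a_2, ..., a_n). *)
Definition replace_first n a (alpha : 'I_n.+1 -> U) : 'I_n -> U :=
  fun i => if i == 0 :> nat then a else alpha (widen_ord (leqnSn n) i).

Definition same_theory n a (alpha : 'I_n.+1 -> U) : Prop :=
  forall m (phi : form_set (n + m)) (s : 'I_m -> U), (forall i, V a (s i)) ->
    (sat_set (@elem U) (V (alpha ord_max)) phi
       (cat_env (replace_first a alpha) s) <->
     sat_set (@elem U) (V (alpha ord_max)) phi
       (cat_env (replace_first (alpha ord0) alpha) s)).

Definition B7a (n : nat) : Prop :=
  forall a, V l a -> ordinal a ->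
    (R a <->
     forall alpha : 'I_n.+1 -> U,
       (forall i, V l (alpha i) /\ R (alpha i)) ->
       ole a (alpha ord0) ->
       (forall i j : 'I_n.+1, i < j -> alpha i ∈ alpha j) ->
       same_theory a alpha).

Definition weakly_reflective_axioms (n : nat) : Prop :=
  [/\ models_zfc (@elem U) (V l), A1, A2, A6 & B7a n].

End WeaklyReflective.

Section Reflective.
Variables (l : U) (R : U -> U -> Prop).

(* [level k a] is R(k, a) for the natural number k, i.e. membership in R_k. *)
Definition level (k : nat) a : Prop := exists y, numeral k y /\ R y a.

Definition is_unordered_pair p x y : Prop :=
  forall z, z ∈ p <-> z = x \/ z = y.

Definition is_pair p x y : Prop :=
  forall z, z ∈ p <-> is_unordered_pair z x x \/ is_unordered_pair z x y.

Definition B2 : Prop :=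
  forall x, V l x -> exists w, V l w /\
    forall p, V l p ->
      (p ∈ w <-> p ∈ x /\ exists y z, [/\ V l y, V l z, is_pair p y z & R y z]).

Definition B3 (n : nat) : Prop :=
  forall y z, V l y -> V l z -> R y z ->
    [/\ ordinal y, exists k, k <= n /\ numeral k y & ordinal z].

Definition B4 : Prop :=
  forall x, V l x -> (level 0 x <-> regular x /\ uncountable_cardinal x).

Definition B5 (n : nat) : Prop :=
  forall k a, k < n -> V l a -> level k.+1 a -> level k a.

(* Vacuous: the levels are bounded by the natural number [n]. *)
Definition B6 (n : nat) : Prop :=
  forall k y a, k <= n -> numeral k y -> limit y -> V l a ->
    (R y a <-> forall m, m ∈ y -> R m a).

Definition B7 (n : nat) : Prop :=
  forall k a b c, k < n -> ordinal a -> ordinal b -> ordinal c -> V l c ->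
    (exists z, z ∈ a) -> a ∈ b -> b ∈ c -> level k.+1 b -> level k.+1 c ->
    (level k.+1 a <->
     forall (phi : form_un 2) s, V a s ->
       (sat_un (@elem U) (V b) (level k) phi (env2 a s) <->
        sat_un (@elem U) (V c) (level k) phi (env2 b s))).

Definition correct (m : nat) mu : Prop :=
  forall phi : form_bin 1, alternating true m phi ->
    forall s, V mu s ->
      (sat_bin (@elem U) (V mu) R phi (env1 s) <->
       sat_bin (@elem U) (V l) R phi (env1 s)).

Definition B8 (n : nat) : Prop :=
  forall m, exists mu, [/\ V l mu, cardinal mu, level n mu & correct m mu].

Definition reflective_axioms (n : nat) : Prop :=
  [/\ models_zfc (@elem U) (V l), B2, B3 n & B4] /\
  [/\ B5 n, B6 n, B7 n & B8 n].

End Reflective.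

End SetTheory.

(* Main.v *)
(* From a subtle [kappa] and countably many relations on finite sequences of
elements of [V_kappa], one gets [b_0 < ... < b_(n-1) < kappa] with
[lambda = b_0] inaccessible such that the set [h] of all [a < lambda] for which
[(a, b_0, ..., b_(n-2))] and [(b_0, ..., b_(n-1))] have the same type over [V_a]
is stationary in [lambda]: otherwise add to the relations a club of [b_0]
disjoint from this set, as a function of [b]; subtlety provides
[a_0 < ... < a_n] such that [(a_0, ..., a_(n-1))] and [(a_1, ..., a_n)] have the
same type over [V_(a_0)], so that [a_0] lies both in the club and in the set
attached to [(a_1, ..., a_n)].  Singular [b_0] are excluded in the same way, by
recording a cofinal map.  Replacing the entries of an increasing sequence of
elements of [h] by those of [b] one after the other, starting from the right,
shows that the elements of [h] are indiscernible over [b].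

If the relations contain the truth predicate of [V_kappa] and counterexamples to
the indescribability and to the ineffability of the cardinals below [kappa],
then [lambda] has no such counterexample.  The weakly reflective ordinals are the
[a < lambda] whose type over [V_a] in [V_kappa] is as for the members of [h];
the [(k+1)]-reflective ones are defined by the same condition, in [V_lambda] with
a predicate for [k]-reflectiveness, a predicate which depends only on
[b_0, ..., b_(k-1)] and can therefore be added to the relations beforehand.  As
[h] is stationary, some member of [h] is correct for any given formula, and
whatever is expressible in [V_kappa] is transferred from [lambda] to all the
(weakly) reflective ordinals. *)

Require Import Defs.
From mathcomp Require Import all_boot.
Import Defs.
From Stdlib Require Import Classical ClassicalEpsilon FunctionalExtensionality.
From Stdlib Require List.

Set Implicit Arguments.
Unset Strict Implicit.
Unset Printing Implicit Defensive.

(** * Sets, ordinals and the cumulative hierarchy *)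

Section SetOperations.
Variable U : universe.
Implicit Types (x y z w a b c d l : U).

Lemma set_ext x y : (forall z, z ∈ x <-> z ∈ y) -> x = y.
Proof. by move=> h; apply: (zfc_extensionality (universe_zfc U)). Qed.

(** Indefinite description turns the existence axioms into operations, here and below. Separation
    holds in the universe for every predicate of the metatheory, so [A] is arbitrary. *)
Definition sep_spec x (A : U -> Prop) :
  {y | forall z, z ∈ y <-> z ∈ x /\ A z}.
Proof.
apply: constructive_indefinite_description.
have [y [_ h]] := zfc_separation (universe_zfc U) (A := A) I (x := x) I.
by exists y => z; apply: h.
Qed.
Definition sep x A := sval (sep_spec x A).
Lemma in_sep x A z : z ∈ sep x A <-> z ∈ x /\ A z.
Proof. exact: (svalP (sep_spec x A)). Qed.

Definition upair_spec x y : {p | forall z, z ∈ p <-> z = x \/ z = y}.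
Proof.
apply: constructive_indefinite_description.
have [p [_ h]] := zfc_pairing (universe_zfc U) (x := x) (y := y) I I.
by exists p => z; apply: h.
Qed.
Definition upair x y := sval (upair_spec x y).
Lemma in_upair x y z : z ∈ upair x y <-> z = x \/ z = y.
Proof. exact: (svalP (upair_spec x y)). Qed.

Definition Union_spec x : {u | forall z, z ∈ u <-> exists y, y ∈ x /\ z ∈ y}.
Proof.
apply: constructive_indefinite_description.
have [u [_ h]] := zfc_union (universe_zfc U) (x := x) I.
exists u => z; rewrite h //; split; first by case=> y [_ ? ?]; exists y.
by case=> y [? ?]; exists y.
Qed.
Definition Union x := sval (Union_spec x).
Lemma in_Union x z : z ∈ Union x <-> exists y, y ∈ x /\ z ∈ y.
Proof. exact: (svalP (Union_spec x)). Qed.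

Definition power_spec x : {p | forall z, z ∈ p <-> subset z x}.
Proof.
apply: constructive_indefinite_description.
have [p [_ h]] := zfc_powerset (universe_zfc U) (x := x) I.
exists p => z; rewrite h //; split; first by move=> hz w; apply: hz.
by move=> hz w _; apply: hz.
Qed.
Definition power x := sval (power_spec x).
Lemma in_power x z : z ∈ power x <-> subset z x.
Proof. exact: (svalP (power_spec x)). Qed.

Definition fimage_spec (f : U -> U) x :
  {y | forall w, w ∈ y <-> exists z, z ∈ x /\ w = f z}.
Proof.
apply: constructive_indefinite_description.
have [|y [_ h]] := zfc_replacement (universe_zfc U) (F := fun z w => w = f z) I _ (x := x) I.
  by move=> z w w' _ _ _ -> ->.
exists y => w; rewrite h //; split; first by case=> z [_ ? ?]; exists z.
by case=> z [? ?]; exists z.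
Qed.
Definition fimage f x := sval (fimage_spec f x).
Lemma in_fimage f x w : w ∈ fimage f x <-> exists z, z ∈ x /\ w = f z.
Proof. exact: (svalP (fimage_spec f x)). Qed.

Definition union2 x y := Union (upair x y).
Lemma in_union2 x y z : z ∈ union2 x y <-> z ∈ x \/ z ∈ y.
Proof.
rewrite in_Union; split.
  by case=> w [/in_upair[->|->] h]; [left|right].
by case=> h; [exists x|exists y]; split=> //; apply/in_upair; [left|right].
Qed.

Definition ssucc x := union2 x (upair x x).
Lemma in_ssucc x z : z ∈ ssucc x <-> z ∈ x \/ z = x.
Proof. by rewrite in_union2 in_upair; tauto. Qed.

Lemma infinity_spec : {x : U | (exists z, z ∈ x /\ forall w, ~ w ∈ z) /\
  forall y, y ∈ x -> ssucc y ∈ x}.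
Proof.
apply: constructive_indefinite_description.
have [x [_ [z [_ zx z0]] h]] := zfc_infinity (universe_zfc U).
exists x; split; first by exists z; split=> // w; apply: z0.
move=> y yx; have [s [_ sx hs]] := h y I yx.
suff -> : ssucc y = s by [].
by apply: set_ext => w; rewrite in_ssucc hs.
Qed.

Definition emptyset : U := sep (sval infinity_spec) (fun=> False).
Lemma in_emptyset z : ~ z ∈ emptyset.
Proof. by move/in_sep => []. Qed.

Fixpoint num m : U := if m is m'.+1 then ssucc (num m') else emptyset.

Lemma numeralP m x : numeral m x <-> x = num m.
Proof.
elim: m x => [|m ih] x /=.
  split=> [h|-> z]; last exact: in_emptyset.
  by apply: set_ext => z; split=> [/h//|]; move/in_emptyset.
split=> [[y [/ih -> h]]|->].
  by apply: set_ext => z; rewrite h in_ssucc.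
by exists (num m); split; [apply/ih|move=> z; exact: in_ssucc].
Qed.

Definition omega : U := sep (sval infinity_spec) (fun z => exists m, z = num m).
Lemma in_omega z : z ∈ omega <-> exists m, z = num m.
Proof.
rewrite in_sep; split=> [[_ //]|[m ->]]; split; last by exists m.
case: (svalP infinity_spec) => [[e [ex e0]] hs].
elim: m => [|m ih] /=; last exact: hs.
suff -> : emptyset = e by [].
apply: set_ext => w; split; first by move/in_emptyset.
by move=> we; case: (e0 w).
Qed.

Lemma foundation x : (exists y, y ∈ x) ->
  exists y, y ∈ x /\ forall z, ~ (z ∈ x /\ z ∈ y).
Proof.
case=> y yx; have [|z [_ zx h]] := zfc_foundation (universe_zfc U) (x := x) I.
  by exists y.
by exists z; split=> // w; apply: h.
Qed.

Lemma elem_irr x : ~ x ∈ x.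
Proof.
move=> xx; have [|y [/in_upair yx h]] := @foundation (upair x x).
  by exists x; apply/in_upair; left.
have {yx} ? : y = x by case: yx.
by subst y; apply: (h x); split=> //; apply/in_upair; left.
Qed.

Lemma num_lt m m' : m < m' -> num m ∈ num m'.
Proof.
elim: m' => // m' ih; rewrite ltnS leq_eqVlt => /orP[/eqP->|/ih h];
  apply/in_ssucc; [by right|by left].
Qed.

Lemma num_inj m m' : num m = num m' -> m = m'.
Proof.
move=> e; case: (ltngtP m m') => // /num_lt; rewrite e => h; by case: (elem_irr h).
Qed.

Definition tc_step x m : U := iter m Union x.
(** Replacement is indexed by a set, so the iterated unions are indexed by [omega], each numeral
    being decoded by [epsilon]. *)
Definition tc x : U :=
  Union (fimage (fun z => tc_step x (epsilon (inhabits 0) (fun m => z = num m))) omega).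

Lemma in_tc x z : z ∈ tc x <-> exists m, z ∈ tc_step x m.
Proof.
rewrite in_Union; split.
  case=> y [/in_fimage[w [_ ->]] h].
  by exists (epsilon (inhabits 0) (fun m => w = num m)).
case=> m h; exists (tc_step x m); split=> //.
apply/in_fimage; exists (num m); split; first by apply/in_omega; exists m.
congr tc_step; apply: num_inj.
exact: (epsilon_spec (inhabits 0) (fun m' => num m = num m') (ex_intro _ m erefl)).
Qed.

(** Foundation is applied to the non-accessible members of the transitive closure of the singleton
    of [x]: the elements of a minimal one are accessible, hence so is it. *)
Lemma elem_wf : well_founded (@elem U).
Proof.
move=> x; apply: NNPP => nx.
pose N := sep (tc (upair x x)) (fun z => ~ Acc (@elem U) z).
have [|y [/in_sep[ty ny] h]] := @foundation N.
  exists x; apply/in_sep; split=> //; apply/in_tc; exists 0; apply/in_upair; by left.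
apply: ny; constructor=> z zy; apply: NNPP => nz; apply: (h z); split=> //.
apply/in_sep; split=> //; move/in_tc: ty => [m ym]; apply/in_tc; exists m.+1 => /=.
by apply/in_Union; exists y.
Qed.

Lemma elem_ind (P : U -> Prop) :
  (forall x, (forall y, y ∈ x -> P y) -> P x) -> forall x, P x.
Proof. by move=> h; apply: (well_founded_ind elem_wf). Qed.

Lemma elem_asym x y : x ∈ y -> ~ y ∈ x.
Proof.
by elim/elem_ind: x y => x ih y xy yx; apply: (ih y yx x).
Qed.

Definition opair x y := upair (upair x x) (upair x y).

Lemma upair_inj x y x' y' : upair x y = upair x' y' ->
  (x = x' /\ y = y') \/ (x = y' /\ y = x').
Proof.
move=> e.
have h z : (z = x \/ z = y) <-> (z = x' \/ z = y') by rewrite -!in_upair e.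
have := (h x).1 (or_introl erefl); have := (h y).1 (or_intror erefl).
have := (h x').2 (or_introl erefl); have := (h y').2 (or_intror erefl).
intuition (subst; auto).
Qed.

Lemma opair_inj x y x' y' : opair x y = opair x' y' -> x = x' /\ y = y'.
Proof.
move=> /upair_inj[[/upair_inj e1 /upair_inj e2]|[/upair_inj e1 /upair_inj e2]];
  intuition (subst; auto).
Qed.

(** A formula code together with its parameters in V_a thus becomes a single element of V_a, for
    limit [a]. *)
Fixpoint code_seq (s : seq U) : U := if s is x :: s' then opair x (code_seq s') else emptyset.

Lemma opair_neq0 x y : opair x y <> emptyset.
Proof.
move=> e; apply: (@in_emptyset (upair x x)); rewrite -e; apply/in_upair; by left.
Qed.

Lemma code_seq_inj : injective code_seq.
Proof.
elim=> [|x s ih] [|y t] //=; [by move/esym/opair_neq0|by move/opair_neq0|].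
by move/opair_inj=> [-> /ih ->].
Qed.

End SetOperations.

Arguments num {U}.
Arguments emptyset {U}.
Arguments omega {U}.

(** * Ordinals and the levels V_a *)

Section Ordinals.
Variable U : universe.
Implicit Types (x y z w a b c d l : U).

Lemma ord_elem a b : ordinal a -> b ∈ a -> ordinal b.
Proof.
move=> [t h] ba; split; first by move=> x xb; apply: h xb.
by move=> x y xb; apply: h; apply: t xb.
Qed.

Lemma ord_trans a b c : ordinal a -> b ∈ a -> c ∈ b -> c ∈ a.
Proof. by move=> [t _] ba; apply: t. Qed.

Lemma ord_trich a b : ordinal a -> ordinal b -> a ∈ b \/ a = b \/ b ∈ a.
Proof.
elim/elem_ind: a b => a iha b oa; elim/elem_ind: b => b ihb ob.
case: (classic (a ∈ b)) => [|nab]; first by left.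
case: (classic (b ∈ a)) => [|nba]; first by right; right.
right; left; apply: set_ext => z; split=> h.
  have := iha z h b (ord_elem oa h) ob; case=> [//|[e|bz]].
    by subst z.
  by case: nba; apply: ord_trans bz.
have := ihb z h (ord_elem ob h); case=> [az|[e|//]].
  by case: nab; apply: ord_trans az.
by subst z.
Qed.

Lemma ord_leVlt a b : ordinal a -> ordinal b -> ole a b \/ b ∈ a.
Proof. by move=> oa ob; case: (ord_trich oa ob) => [|[|]]; [left; left|left; right|right]. Qed.

Lemma ole_trans a b c : ordinal c -> ole a b -> ole b c -> ole a c.
Proof.
by move=> oc [ab|->] [bc|<-] //; try (by left); [left; apply: ord_trans bc ab|right].
Qed.

Lemma ole_lt_trans a b c : ordinal c -> ole a b -> b ∈ c -> a ∈ c.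
Proof. by move=> oc [ab|->] // bc; apply: ord_trans bc ab. Qed.

Lemma lt_ole_trans a b c : ordinal c -> a ∈ b -> ole b c -> a ∈ c.
Proof. by move=> oc ab [bc|<-] //; apply: ord_trans bc ab. Qed.

Lemma ole_subset a b : ordinal b -> ole a b -> subset a b.
Proof. by move=> [t _] [/t//|->]. Qed.

Lemma subset_ole a b : ordinal a -> ordinal b -> subset a b -> ole a b.
Proof. by move=> oa ob s; case: (ord_leVlt oa ob) => // /s /elem_irr. Qed.

Lemma ole_refl a : ole a a. Proof. by right. Qed.

Lemma ex_least (A : U -> Prop) : (exists a, A a) -> (forall a, A a -> ordinal a) ->
  exists a, least a A.
Proof.
move=> [a Aa] oA; elim/elem_ind: a Aa => a ih Aa.
case: (classic (exists b, b ∈ a /\ A b)) => [[b [ba Ab]]|n]; first exact: (ih b).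
exists a; split=> // b Ab; case: (ord_leVlt (oA _ Aa) (oA _ Ab)) => // ba.
by case: n; exists b.
Qed.

Lemma ord_succ a : ordinal a -> ordinal (ssucc a).
Proof.
move=> [t h]; split.
  move=> x /in_ssucc[xa|->] y yx; apply/in_ssucc; left=> //; exact: t yx.
by move=> x y /in_ssucc[xa|->]; [apply: h|move/t].
Qed.

Lemma in_ssucc_self a : a ∈ ssucc a. Proof. by apply/in_ssucc; right. Qed.

Lemma in_ssucc_ole a b : b ∈ ssucc a <-> ole b a.
Proof. exact: in_ssucc. Qed.

Lemma ord_Union x : (forall a, a ∈ x -> ordinal a) -> ordinal (Union x).
Proof.
move=> ox; split.
  move=> y /in_Union[a [ax ya]] z zy; apply/in_Union; exists a; split=> //.
  by apply: ord_trans zy => //; exact: ox.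
move=> y z /in_Union[a [ax ya]]; exact: (ox a ax).2.
Qed.

Lemma ole_Union x a : (forall b, b ∈ x -> ordinal b) -> a ∈ x -> ole a (Union x).
Proof.
move=> ox ax; apply: subset_ole; [exact: ox|exact: ord_Union|].
by move=> z za; apply/in_Union; exists a.
Qed.

Lemma ord_empty : ordinal (@emptyset U).
Proof. by split=> x; [move/in_emptyset|move=> y /in_emptyset]. Qed.

Lemma ord_num m : ordinal (@num U m).
Proof. by elim: m => [|m ih]; [exact: ord_empty|exact: ord_succ]. Qed.

Lemma ord_omega : ordinal (@omega U).
Proof.
have lt m : forall x, x ∈ @num U m -> exists m', x = num m'.
  elim: m => [|m ih] x /=; first by move/in_emptyset.
  by case/in_ssucc=> [/ih//|->]; exists m.
split; first by move=> x /in_omega[m ->] y /lt h; apply/in_omega.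
by move=> x y /in_omega[m ->]; apply: (ord_num m).1.
Qed.

Lemma limit_succ l a : limit l -> a ∈ l -> ssucc a ∈ l.
Proof.
move=> [ol _ h] al; have [b [bl ab]] := h a al.
have ob := ord_elem ol bl.
have s : subset (ssucc a) b by move=> x /in_ssucc[xa|->//]; apply: ord_trans xa.
apply: ole_lt_trans bl => //; apply: subset_ole => //.
by apply: ord_succ; apply: ord_elem al.
Qed.

Lemma limit0 l : limit l -> emptyset ∈ l.
Proof.
move=> [ol [b bl] _]; case: (ord_trich (ord_empty) ol) => [//|[e|/in_emptyset//]].
by move: bl; rewrite -e => /in_emptyset.
Qed.

Lemma limit_num l m : limit l -> num m ∈ l.
Proof. by move=> h; elim: m => [|m ih] /=; [exact: limit0|exact: limit_succ]. Qed.

Definition omax a b := union2 a b.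

Lemma ord_max2 a b : ordinal a -> ordinal b -> ordinal (omax a b).
Proof. by move=> oa ob; apply: ord_Union => c /in_upair[]->. Qed.

Lemma omax_cases a b : ordinal a -> ordinal b -> omax a b = a \/ omax a b = b.
Proof.
move=> oa ob; case: (ord_leVlt oa ob) => h; [right|left];
  apply: set_ext => z; rewrite in_union2; split; try tauto; case=> //.
  exact: ole_subset.
by apply: ole_subset => //; left.
Qed.

Lemma omax_lt l a b : ordinal l -> a ∈ l -> b ∈ l -> omax a b ∈ l.
Proof. by move=> ol al bl; case: (omax_cases (ord_elem ol al) (ord_elem ol bl)) => ->. Qed.

Lemma omax_l a b : ordinal a -> ordinal b -> ole a (omax a b).
Proof.
move=> oa ob; apply: subset_ole => //; first exact: ord_max2.
by move=> z; rewrite in_union2; left.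
Qed.

Lemma omax_r a b : ordinal a -> ordinal b -> ole b (omax a b).
Proof.
move=> oa ob; apply: subset_ole => //; first exact: ord_max2.
by move=> z; rewrite in_union2; right.
Qed.

Lemma V_sub a b x : subset a b -> V a x -> V b x.
Proof. by move=> s [c ca h]; exists c; first exact: s. Qed.

Lemma V_le a b x : ordinal b -> ole a b -> V a x -> V b x.
Proof. by move=> ob h; apply: V_sub; apply: ole_subset. Qed.

Lemma V_lt a b x : ordinal b -> a ∈ b -> V a x -> V b x.
Proof. by move=> ob h; apply: V_le => //; left. Qed.

Lemma V_trans a x y : ordinal a -> V a x -> y ∈ x -> V a y.
Proof. by move=> oa [b ba h] yx; apply: V_lt (h _ yx). Qed.

Lemma V_subset a x y : V a x -> subset y x -> V a y.
Proof. by move=> [b ba h] s; exists b => // z /s /h. Qed.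

Definition Vset_spec a : {v | forall x, x ∈ v <-> V a x}.
Proof.
apply: constructive_indefinite_description; elim/elem_ind: a => a ih.
pose f b := epsilon (inhabits b) (fun v => forall x, x ∈ v <-> V b x).
have fP b : b ∈ a -> forall x, x ∈ f b <-> V b x.
  by move=> /ih; apply: (epsilon_spec (inhabits b)).
exists (Union (fimage (fun b => power (f b)) a)) => x; rewrite in_Union; split.
  case=> y [/in_fimage[b [ba ->]]] /in_power s; exists b => // z /s.
  by rewrite fP.
case=> b ba h; exists (power (f b)); split; first by apply/in_fimage; exists b.
by apply/in_power => z /h; rewrite fP.
Qed.
Definition Vset a := sval (Vset_spec a).
Lemma in_Vset a x : x ∈ Vset a <-> V a x.
Proof. exact: (svalP (Vset_spec a)). Qed.

Lemma V_ord a b : ordinal a -> ordinal b -> (V a b <-> b ∈ a).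
Proof.
move=> oa ob; split.
  elim/elem_ind: a oa b ob => a ih oa b ob [c ca h].
  have oc := ord_elem oa ca.
  apply: (ole_lt_trans oa _ ca); apply: subset_ole => // z zb.
  by apply: ih => //; [exact: ord_elem zb|exact: h].
elim/elem_ind: b a oa ob => b ih a oa ob ba; exists b => // y yb.
by apply: ih => //; exact: ord_elem yb.
Qed.

Lemma V_Vset a b : ordinal a -> b ∈ a -> V a (Vset b).
Proof. by move=> oa ba; exists b => // y /in_Vset. Qed.

Lemma V_rank x : exists a, ordinal a /\ V a x.
Proof.
elim/elem_ind: x => x ih.
pose r y := epsilon (inhabits y) (fun a => ordinal a /\ V a y).
have rP y : y ∈ x -> ordinal (r y) /\ V (r y) y.
  by move=> /ih; apply: (epsilon_spec (inhabits y)).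
have os b : b ∈ fimage r x -> ordinal b by case/in_fimage=> y [/rP[h _] ->].
have oU := ord_Union os.
exists (ssucc (Union (fimage r x))); split; first exact: ord_succ.
exists (Union (fimage r x)); first exact: in_ssucc_self.
move=> y yx; apply: (V_le oU _ (rP _ yx).2); apply: ole_Union => //.
by apply/in_fimage; exists y.
Qed.

Section Limit.
Variable l : U.
Hypothesis ll : limit l.

Let ol : ordinal l. Proof. by case: ll. Qed.

Lemma V_limit x : V l x -> exists2 b, b ∈ l & V b x.
Proof.
move=> [b bl h]; exists (ssucc b); first exact: limit_succ.
by exists b => //; exact: in_ssucc_self.
Qed.

Lemma V_upair x y : V l x -> V l y -> V l (upair x y).
Proof.
move=> /V_limit[b bl bx] /V_limit[c cl cy].
have [ob oc] := (ord_elem ol bl, ord_elem ol cl).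
exists (omax b c); first exact: omax_lt.
by move=> z /in_upair[]->; [apply: V_le bx|apply: V_le cy];
  [exact: ord_max2|exact: omax_l|exact: ord_max2|exact: omax_r].
Qed.

Lemma V_pair x y : V l x -> V l y -> V l (opair x y).
Proof. by move=> lx ly; apply: V_upair; apply: V_upair. Qed.

Lemma V_power x : V l x -> V l (power x).
Proof.
move=> [b bl h]; exists (ssucc b); first exact: limit_succ.
by move=> y /in_power s; exists b; [exact: in_ssucc_self|move=> z /s/h].
Qed.

Lemma V_Union x : V l x -> V l (Union x).
Proof.
move=> [b bl h]; exists b => // z /in_Union[y [/h yb zy]].
by apply: V_trans yb zy; exact: ord_elem bl.
Qed.

Lemma V_num m : V l (num m).
Proof. by apply/V_ord => //; [exact: ord_num|exact: limit_num]. Qed.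

Lemma V_code_seq s : (forall x, List.In x s -> V l x) -> V l (code_seq s).
Proof.
elim: s => [|x s ih] h /=; first exact: (V_num 0).
by apply: V_pair; [apply: h; left|apply: ih => y ys; apply: h; right].
Qed.

End Limit.

End Ordinals.

(** * Increasing sequences, inaccessible ordinals and closure points *)

Local Notation hd := (head emptyset).

Section IncreasingSequences.
Variable U : universe.
Implicit Types (x y z a b c l : U) (s t : seq U).

Fixpoint increasing s : Prop :=
  if s is x :: s' then (forall y, List.In y s' -> x ∈ y) /\ increasing s' else True.

Fixpoint set_of s : U := if s is x :: s' then union2 (upair x x) (set_of s') else emptyset.

Lemma in_set_of s z : z ∈ set_of s <-> List.In z s.
Proof.
elim: s => [|x s ih] /=; first by split=> // /in_emptyset.
rewrite in_union2 in_upair ih; intuition.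
Qed.

Lemma increasing_insert s a : (forall b, List.In b s -> ordinal b) -> ordinal a ->
  increasing s -> ~ List.In a s ->
  exists t, [/\ increasing t, size t = (size s).+1 &
    forall z, List.In z t <-> z = a \/ List.In z s].
Proof.
elim: s => [|x s ih] os oa /=; first by exists [:: a]; split=> //= z; intuition.
move=> [xs ss] na.
case: (ord_trich oa (os x (or_introl erefl))) => [ax|[e|xa]].
- exists (a :: x :: s); split=> //=; last by move=> z; intuition.
  split=> // y [<-//|ys]; apply: ord_trans (xs _ ys) ax.
  by apply: os; right.
- by case: na; left.
have [|//|//||t [st zt ht]] := ih; first by move=> b bs; apply: os; right.
  by move=> h; apply: na; right.
exists (x :: t); split=> /=; [|by rewrite zt|by move=> z; rewrite ht; intuition].
by split=> // y /ht[->//|/xs].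
Qed.

(** Insertion sort. Types are attached to increasing sequences, whereas the partition notions speak
    of [m]-element sets. *)
Lemma has_size_increasing m x : (forall a, a ∈ x -> ordinal a) -> has_size m x ->
  exists s, [/\ increasing s, size s = m & forall z, z ∈ x <-> List.In z s].
Proof.
move=> ox [e [inj_e hx]].
suff h (r : seq 'I_m) : uniq r -> exists s, [/\ increasing s, size s = size r &
    forall z, List.In z s <-> exists2 i, i \in r & z = e i].
  have [s [ss zs hs]] := h (enum 'I_m) (enum_uniq _).
  exists s; split=> //; first by rewrite zs size_enum_ord.
  move=> z; rewrite hx hs; split; last by case=> i _; exists i.
  by case=> i ->; exists i => //; rewrite mem_enum.
elim: r => [|i r ih] /=; first by exists [::]; split=> // z; split=> // -[].
case/andP=> ir /ih[s [ss zs hs]].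
have oe j : ordinal (e j) by apply: ox; apply/hx; exists j.
have [||//||t [st zt ht]] := @increasing_insert s (e i).
- by move=> b /hs[j _ ->].
- exact: oe.
- by move=> /hs[j jr /inj_e ij]; rewrite ij jr in ir.
exists t; split=> //; first by rewrite zt zs.
move=> z; rewrite ht hs; split.
  by move=> [->|[j jr ->]]; [exists i; rewrite ?mem_head|exists j; rewrite // in_cons jr orbT].
by case=> j; rewrite in_cons => /orP[/eqP->|jr] ->; [left|right; exists j].
Qed.

Lemma increasing_nth s i j : increasing s -> i < j -> j < size s ->
  nth emptyset s i ∈ nth emptyset s j.
Proof.
elim: s i j => [|x s ih] [|i] [|j] //= [xs ss]; last by rewrite !ltnS; apply: ih.
move=> _; rewrite ltnS => js; apply: xs.
elim: s j js {ih ss} => // y s ih [|j] /= js; first by left.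
by right; apply: ih.
Qed.

Lemma In_nth s z : List.In z s <-> exists2 i, i < size s & z = nth emptyset s i.
Proof.
elim: s => [|x s ih] /=; first by split=> // -[].
rewrite ih; split.
  by case=> [->|[i h ->]]; [exists 0|exists i.+1].
by case=> -[|i] h ->; [left|right; exists i].
Qed.

Lemma increasing_has_size s : increasing s -> has_size (size s) (set_of s).
Proof.
move=> ss; exists (fun i => nth emptyset s i); split.
  move=> i j e; apply: val_inj; case: (ltngtP i j) => // h.
    by have := increasing_nth ss h (ltn_ord j); rewrite e => /elem_irr.
  by have := increasing_nth ss h (ltn_ord i); rewrite e => /elem_irr.
move=> z; rewrite in_set_of In_nth; split; first by case=> i h ->; exists (Ordinal h).
by case=> i ->; exists (val i); first exact: ltn_ord.
Qed.

Lemma increasing_uniq s t : increasing s -> increasing t ->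
  (forall z, List.In z s <-> List.In z t) -> s = t.
Proof.
elim: s t => [|x s ih] [|y t] //=.
- by move=> _ _ h; case: ((h y).2 (or_introl erefl)).
- by move=> _ _ h; case: ((h x).1 (or_introl erefl)).
move=> [xs ss] [yt st] h.
have e : x = y.
  case: ((h x).1 (or_introl erefl)) => [//|/yt yx].
  by case: ((h y).2 (or_introl erefl)) => [//|/xs/elem_asym].
subst y; congr cons; apply: ih => // z; split=> hz.
  by case: ((h z).1 (or_intror hz)) => // e; move: (xs _ hz); rewrite e => /elem_irr.
by case: ((h z).2 (or_intror hz)) => // e; move: (yt _ hz); rewrite e => /elem_irr.
Qed.

Lemma In_take k s z : List.In z (take k s) -> List.In z s.
Proof. by elim: s k => [|x s ih] [|k] //= [->|/ih]; [left|right]. Qed.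

Lemma increasing_take k s : increasing s -> increasing (take k s).
Proof.
by elim: s k => [|x s ih] [|k] //= [xs ss]; split; [move=> y /In_take/xs|exact: ih].
Qed.

Lemma increasing_behead s : increasing s -> increasing (behead s).
Proof. by case: s => //= x s []. Qed.

Lemma In_behead s z : List.In z (behead s) -> List.In z s.
Proof. by case: s => //= x s; right. Qed.

End IncreasingSequences.

(** * Inaccessible ordinals and clubs of closure points *)

Section Inaccessible.
Variable U : universe.
Implicit Types (x y z a b c l : U).

(* The boundedness condition amounts to regularity and strong limitness together. *)
Definition inaccessible l : Prop :=
  [/\ limit l, omega ∈ l &
    forall X (f : U -> U), V l X -> (forall x, x ∈ X -> f x ∈ l) ->
      exists2 c, c ∈ l & forall x, x ∈ X -> f x ∈ c].

Definition closed_under (F : U -> U) l : Prop := forall a, a ∈ l -> F a ∈ l.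

(** A left inverse of an injection of [l] into [b] would map [b], an element of V_l, onto an
    unbounded subset of [l]. *)
Lemma no_injection l b (f : U -> U) : inaccessible l -> b ∈ l ->
  (forall x, x ∈ l -> f x ∈ b) ->
  ~ (forall x y, x ∈ l -> y ∈ l -> f x = f y -> x = y).
Proof.
move=> [ll _ h] bl fb fi.
have [ol _ _] := ll.
pose g y := epsilon (inhabits emptyset) (fun x => x ∈ l /\ (forall x', x' ∈ l -> f x' = y -> x' = x)).
have gP x : x ∈ l -> g (f x) = x.
  move=> xl; have [] := epsilon_spec (inhabits emptyset) (fun x0 => x0 ∈ l /\ (forall x', x' ∈ l -> f x' = f x -> x' = x0)).
    by exists x; split=> // x' x'l; apply: fi.
  by move=> _ /(_ x xl erefl).
pose g' y := if excluded_middle_informative (g y ∈ l) then g y else emptyset.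
have [||c cl hc] := h b g'.
- by apply/V_ord => //; apply: ord_elem bl.
- by move=> y _; rewrite /g'; case: (excluded_middle_informative (g y ∈ l)) => h' //; exact: limit0.
have := hc _ (fb _ cl); rewrite /g' gP //.
by case: (excluded_middle_informative (c ∈ l)) => h' // /elem_irr.
Qed.

Lemma inaccessible_regular l : inaccessible l -> regular l.
Proof.
move=> il; have [ll ol h] := il; have [odl _ _] := ll; split.
- split=> // b bl [f [h1 h2]]; exact: (no_injection il bl h1).
- by move=> m x /numeralP ->; apply: limit_num.
move=> b f bl fb; have [|//|c cl hc] := h b f; last by exists c.
by apply/V_ord => //; apply: ord_elem bl.
Qed.

Lemma inaccessible_uncountable l : inaccessible l -> uncountable_cardinal l.
Proof.
move=> il; have [cl _ _] := inaccessible_regular il; split=> //.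
exists omega; have [_ oml _] := il; split=> // m x /numeralP ->.
by apply/in_omega; exists m.
Qed.

Section Clubs.
Variable l : U.
Hypothesis il : inaccessible l.

Let ll : limit l. Proof. by case: il. Qed.
Let ol : ordinal l. Proof. by case: ll. Qed.

Lemma seq_bound (u : nat -> U) : (forall m, u m ∈ l) -> exists2 c, c ∈ l & forall m, u m ∈ c.
Proof.
move=> ul; have [_ oml h] := il.
pose f z := u (epsilon (inhabits 0) (fun m => z = num m)).
have [||c cl hc] := h omega f.
- by apply/V_ord => //; exact: ord_omega.
- by move=> x _; apply: ul.
exists c => // m; have := hc (num m); rewrite /f.
have <- := num_inj (epsilon_spec (inhabits 0) (fun m' => @num U m = num m') (ex_intro _ m erefl)).
by apply; apply/in_omega; exists m.
Qed.

Lemma fun_bound (F : U -> U) : closed_under F l ->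
  exists G, closed_under G l /\ forall a x, a ∈ l -> x ∈ a -> F x ∈ G a.
Proof.
move=> Fl; have [_ _ h] := il.
pose B a c := c ∈ l /\ forall x, x ∈ a -> F x ∈ c.
pose G a := epsilon (inhabits a) (B a).
have P a : a ∈ l -> B a (G a).
  move=> al; apply: epsilon_spec.
  have [||c cl hc] := h a F; [| |by exists c].
    by apply/V_ord => //; apply: ord_elem al.
  by move=> x xa; apply: Fl; apply: ord_trans xa.
by exists G; split=> [a /P[]//|a x /P[_ h']]; exact: h'.
Qed.

Definition closure_points (F : U -> U) : U := sep l (fun b => limit b /\ closed_under F b).

Lemma in_closure_points F b : b ∈ closure_points F <-> [/\ b ∈ l, limit b & closed_under F b].
Proof. by rewrite in_sep; split=> [[? []]|[]]. Qed.

(** Iterating the maximum of the successor and of a bound [G] for the values of [F] gives a sequence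
    whose supremum is a limit closed under [F]. *)
Lemma closure_points_unbounded F a : closed_under F l -> a ∈ l ->
  exists b, b ∈ closure_points F /\ a ∈ b.
Proof.
move=> /fun_bound[G [Gl hG]] al.
pose u m := iter m (fun s => omax (ssucc s) (G s)) a.
have ul m : u m ∈ l.
  by elim: m => [//|m ih] /=; apply: omax_lt => //; [exact: limit_succ|exact: Gl].
have ou m := ord_elem ol (ul m).
have oG m : ordinal (G (u m)) by apply: ord_elem ol _; apply: Gl.
have us m : ole (ssucc (u m)) (u m.+1) by apply: omax_l => //; exact: ord_succ.
have uG m : ole (G (u m)) (u m.+1) by apply: omax_r => //; exact: ord_succ.
have [c cl hc] := seq_bound ul.
have [||b [[bu bl] mb]] := @ex_least U (fun c => (forall m, u m ∈ c) /\ c ∈ l).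
- by exists c.
- by move=> b [_ /(ord_elem ol)].
have ob := ord_elem ol bl.
have xb x : x ∈ b -> exists m, ole x (u m).
  move=> xb; apply: NNPP => n; have xl : x ∈ l by apply: ord_trans bl xb.
  have ox := ord_elem ol xl.
  have : ole b x.
    apply: mb; split=> // m; case: (ord_leVlt ox (ou m)) => // h; by case: n; exists m.
  by move=> h; apply: (@elem_irr _ b); apply: ole_lt_trans h xb.
have xu x : x ∈ b -> exists m, x ∈ u m.
  move=> /xb[m h]; exists m.+1; apply: lt_ole_trans (us m) => //.
  exact/in_ssucc_ole.
exists b; split; last exact: (bu 0).
apply/in_closure_points; split=> //.
  split=> //; first by exists a; exact: (bu 0).
  by move=> x /xu[m h]; exists (u m).
move=> x /xu[m h]; apply: ord_trans (bu m.+1) _ => //.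
by apply: lt_ole_trans (uG m) => //; apply: hG.
Qed.

Lemma closure_points_club F : closed_under F l -> club l (closure_points F).
Proof.
move=> Fl; split.
- by move=> x /in_sep[].
- by move=> a al; have [b [h1 h2]] := closure_points_unbounded Fl al; exists b; split=> //; left.
move=> a al la h; apply/in_closure_points; split=> // x xa.
(* The bound is only in the sense of [ole]; starting from the successor of [x] gives a closure point
   strictly above [x]. *)
have [d [/in_closure_points[dl ld Fd] da xd]] := h _ (limit_succ la xa).
have [od _ _] := ld.
have oa := ord_elem ol al.
apply: ord_trans da _ => //; apply: Fd; apply: lt_ole_trans xd => //; exact: in_ssucc_self.
Qed.

(** [G a] lies above the countably many [F m a], so that a single function controls closure under
    the whole family. *)
Lemma closed_under_all (F : nat -> U -> U) : (forall m, closed_under (F m) l) ->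
  exists G, closed_under G l /\
    forall b, b ∈ l -> limit b -> closed_under G b -> forall m, closed_under (F m) b.
Proof.
move=> Fl.
pose B a c := c ∈ l /\ forall m, F m a ∈ c.
pose G a := epsilon (inhabits a) (B a).
have P a : a ∈ l -> B a (G a).
  move=> al; apply: epsilon_spec; have [|c cl hc] := @seq_bound (fun m => F m a).
    by move=> m; apply: Fl.
  by exists c.
exists G; split=> [a /P[]//|b bl lb h m a ab].
have [ob _ _] := lb.
have [_ /(_ m)] := P a (ord_trans ol bl ab).
by apply: ord_trans => //; apply: h.
Qed.

Lemma closed_under2 (F G : U -> U) : closed_under F l -> closed_under G l ->
  exists H, closed_under H l /\
    forall b, b ∈ l -> limit b -> closed_under H b -> closed_under F b /\ closed_under G b.
Proof.
move=> Fl Gl; have [|H [Hl hH]] := closed_under_all (F := fun m => if m is 0 then F else G).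
  by case.
by exists H; split=> // b bl lb /(hH b bl lb) h; split; [exact: (h 0)|exact: (h 1)].
Qed.

Lemma stationary_closure_point h F : stationary l h -> closed_under F l ->
  exists a, [/\ a ∈ h, a ∈ l, limit a & closed_under F a].
Proof.
move=> [_ sh] /closure_points_club/sh[a [ah /in_closure_points[]]].
by exists a.
Qed.

End Clubs.
End Inaccessible.

(** * Subtle cardinals *)

Section Subtle.
Variables (U : universe) (n : nat) (kappa : U).
Implicit Types (x y z a b c l : U) (s t : seq U).
Hypotheses (n_gt0 : 0 < n) (card_kappa : cardinal kappa) (subtle_kappa : subtle n kappa).

Let ok : ordinal kappa. Proof. by case: card_kappa. Qed.

(** The regressive function collects the [z] below all elements of [x] that are related by [Q] to
    the increasing enumeration of [x]. In a homogeneous set of [n.+1] elements, the first [n] and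
    the last [n] form two sets whose joint minimum is the first element. *)
Lemma subtle_sequence c (Q : U -> seq U -> Prop) : club kappa c ->
  exists s, [/\ size s = n.+1, increasing s, forall a, List.In a s -> a ∈ c &
    forall z, z ∈ hd s -> (Q z (take n s) <-> Q z (behead s))].
Proof.
move=> cc; have [ck _ _] := cc.
pose B x z := (forall a, a ∈ x -> z ∈ a) /\
  exists s, [/\ increasing s, (forall z, z ∈ x <-> List.In z s) & Q z s].
pose f x := sep (Union x) (B x).
case: subtle_kappa => _ /(_ c f cc)[|h [[hc hsz] hom]].
  by move=> x a _ [ax _] z /in_sep[_ [/(_ a ax)]].
have [|s [ss zs hs]] := has_size_increasing _ hsz.
  by move=> a /hc/ck/(ord_elem ok).
exists s; split=> //; first by move=> a /hs/hc.
case: s ss zs hs => [|a s] // ss [zs] hs.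
have tup t : increasing t -> size t = n -> (forall z, List.In z t -> List.In z (a :: s)) ->
    tuples n h (set_of t).
  move=> st <- h'; split; last exact: increasing_has_size.
  by move=> z /in_set_of/h'/hs.
have t1 : tuples n h (set_of (take n (a :: s))).
  apply: tup; first exact: increasing_take.
    by rewrite size_take /= zs ltnS leqnn.
  by move=> z; apply: In_take.
have t2 : tuples n h (set_of s).
  by apply: tup => //; [exact: (increasing_behead ss)|move=> z; right].
have least_a : least a (fun z => z ∈ set_of (take n (a :: s)) \/ z ∈ set_of s).
  split; first by left; apply/in_set_of; case: (n) n_gt0 => //= m _; left.
  move=> b [/in_set_of/In_take|/in_set_of h'].
    by case=> [->|h']; [right|left; apply: ss.1].
  by left; apply: ss.1.
have fE t z : increasing t -> size t = n -> (forall w, List.In w t -> z ∈ w) ->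
    (z ∈ f (set_of t) <-> Q z t).
  move=> st zt zl; rewrite in_sep; split.
    move=> [_ [_ [t' [st' ht' q]]]].
    suff -> : t = t' by [].
    by apply: increasing_uniq => // w; rewrite -ht' in_set_of.
  move=> q; split.
    case: t st zt zl q => [|w t] st zt zl q; first by move: n_gt0; rewrite -zt.
    by apply/in_Union; exists w; split; [apply/in_set_of; left|apply: zl; left].
  split; first by move=> w /in_set_of/zl.
  by exists t; split=> // w; exact: in_set_of.
move=> z /= za; have ob b : List.In b (a :: s) -> z ∈ b.
  case=> [<-//|bs]; apply: ord_trans (ss.1 _ bs) za.
  by apply: ord_elem ok _; apply/ck/hc/hs; right.
rewrite -fE; first 1 last.
- exact: increasing_take.
- by rewrite size_take /= zs ltnS leqnn.
- by move=> w /In_take/ob.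
rewrite -(fE s) //; [|exact: (increasing_behead ss)|by move=> w h'; apply: ob; right].
exact: (hom _ _ _ t1 t2 least_a).
Qed.

(** The case of a relation that depends only on the head: the heads of the two sequences are the two
    smallest ordinals found. *)
Lemma subtle_pair c (f : U -> U) : club kappa c -> exists a b, [/\ a ∈ c, b ∈ c, a ∈ b &
  forall z, z ∈ a -> (z ∈ f a <-> z ∈ f b)].
Proof.
move=> /(subtle_sequence (fun z s => z ∈ f (hd s)))[s [zs ss sc h]].
case: s zs ss sc h => [|a [|b s]] //=; first by case=> e; move: n_gt0; rewrite -e.
move=> _ [ab _] sc h; exists a, b; split.
- by apply: sc; left.
- by apply: sc; right; left.
- by apply: ab; left.
by move=> z /h; case: (n) n_gt0.
Qed.

Lemma subtle_limit : limit kappa.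
Proof.
have k0 : exists b, b ∈ kappa.
  have [|a [b [_ bk _ _]]] := @subtle_pair kappa (fun=> emptyset); last by exists b.
  by split=> // a ak; exists a; split=> //; right.
split=> // b bk; apply: NNPP => nb.
have maxb a : a ∈ kappa -> ole a b.
  move=> ak; case: (ord_leVlt (ord_elem ok ak) (ord_elem ok bk)) => // ba.
  by case: nb; exists a.
(* The singleton of a largest element [b] would be a club without two elements. *)
have [|a [d [/in_upair ea /in_upair ed ad _]]] := @subtle_pair (upair b b) (fun=> emptyset).
  split.
  - by move=> z /in_upair[]->.
  - by move=> a /maxb ab; exists b; split=> //; apply/in_upair; left.
  - move=> a ak [oa [e ea] _] h.
    have [d [/in_upair db da _]] := h e ea.
    have {db} ? : d = b by case: db.
    subst d; by move: (maxb a ak) => /(lt_ole_trans (ord_elem ok bk) da) /elem_irr.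
by move: ad; have -> : a = b; [by case: ea|]; have -> : d = b; [by case: ed|]; move/elem_irr.
Qed.

Let lk := subtle_limit.

Lemma subtle_omega : omega ∈ kappa.
Proof.
have oml : subset omega kappa by move=> z /in_omega[m ->]; exact: limit_num.
case: (subset_ole (@ord_omega U) ok oml) => // e.
(* On nonzero numerals [Union] is the predecessor. The predecessor of the smaller member of a pair
   belongs to the singleton attached to that member, but not to the one attached to the larger
   member. *)
pose c := sep kappa (fun b => b <> emptyset).
have [|a [b [/in_sep[ak a0] /in_sep[bk b0] ab h]]] :=
    @subtle_pair c (fun b => upair (Union b) (Union b)).
  split.
  - by move=> z /in_sep[].
  - move=> a ak; exists (ssucc a); split; last by left; exact: in_ssucc_self.
    apply/in_sep; split; first exact: limit_succ.
    by move=> e'; apply: (@in_emptyset U a); rewrite -e'; exact: in_ssucc_self.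
  - move=> a; rewrite -e => /in_omega[[|m] ->]; first by move=> [_ [b /in_emptyset]].
    move=> [_ _ /(_ (num m) (in_ssucc_self _))][d [/in_ssucc[dm md|->]]]; last by move/elem_irr.
    by have := elem_asym dm md.
have US m : Union (@num U m.+1) = num m.
  apply: set_ext => z; rewrite in_Union; split; last by exists (num m); split=> //; exact: in_ssucc_self.
  move=> [y [/in_ssucc[ym zy|->//]]]; apply: ord_trans ym zy; exact: ord_num.
move: ak bk; rewrite -e => /in_omega[m am] /in_omega[m' bm'].
case: m am => [|m] am; first by case: a0.
case: m' bm' => [|m'] bm'; first by case: b0.
move: h; rewrite am bm' !US => /(_ (num m) (in_ssucc_self _))[h _].
have : @num U m ∈ upair (num m') (num m') by apply: h; apply/in_upair; left.
move=> /in_upair e'; have {e'} /num_inj e' : @num U m = num m' by case: e'.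
by move: ab; rewrite am bm' e' => /elem_irr.
Qed.

(* If [F] is unbounded, the sets [{x in b | F x in a}] strictly increase with [a] in
   the club of all [a > b] that are limits (in the sense of [ole]) of values of [F]. *)
Lemma subtle_bound b (F : U -> U) : b ∈ kappa -> (forall x, x ∈ b -> F x ∈ kappa) ->
  exists2 c, c ∈ kappa & forall x, x ∈ b -> F x ∈ c.
Proof.
move=> bk Fk; apply: NNPP => nb.
have ub c : c ∈ kappa -> exists2 x, x ∈ b & ole c (F x).
  move=> ck; apply: NNPP => nx; case: nb; exists c => // x xb.
  case: (ord_leVlt (ord_elem ok ck) (ord_elem ok (Fk x xb))) => // h.
  by case: nx; exists x.
pose c := sep kappa (fun a => b ∈ a /\
  forall d, d ∈ a -> exists x, [/\ x ∈ b, ole d (F x) & F x ∈ a]).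
have [|a [d [/in_sep[ak [ba ha]] /in_sep[dk [bd hd]] ad h]]] :=
    @subtle_pair c (fun a => sep b (fun x => F x ∈ a)).
  split.
  - by move=> z /in_sep[].
  - move=> a ak; have mk := omax_lt ok ak bk; have [x xb hx] := ub _ mk.
    have [oa ob om] := And3 (ord_elem ok ak) (ord_elem ok bk) (ord_elem ok mk).
    have oF := ord_elem ok (Fk x xb).
    exists (ssucc (F x)); split; last first.
      left; apply/in_ssucc_ole; apply: ole_trans hx => //; exact: omax_l.
    apply/in_sep; split; first by apply: limit_succ => //; apply: Fk.
    split; first by apply/in_ssucc_ole; apply: ole_trans hx => //; exact: omax_r.
    by move=> d /in_ssucc_ole dF; exists x; split=> //; exact: in_ssucc_self.
  - move=> a ak la h; have [oa [e ea] _] := la; apply/in_sep; split=> //; split.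
      have [d [/in_sep[dk [bd _]] da _]] := h _ ea; exact: ord_trans da bd.
    move=> d da; have [e' [/in_sep[ek [_ he]] e'a de]] := h _ (limit_succ la da).
    have oe := ord_elem ok ek.
    have de' : d ∈ e' by apply: lt_ole_trans de => //; exact: in_ssucc_self.
    by have [x [xb hx Fx]] := he _ de'; exists x; split=> //; apply: ord_trans Fx.
have [x [xb aF Fd]] := hd a ad.
have [oa od] := (ord_elem ok ak, ord_elem ok dk).
have xa : x ∈ a by apply: ord_trans ba xb.
have [_] := h x xa; rewrite !in_sep => /(_ (conj xb Fd))[_ Fa].
by apply: (@elem_irr _ (F x)); apply: lt_ole_trans aF => //; exact: ord_elem od Fd.
Qed.

(** * Enumeration of V_kappa and inaccessibility of kappa *)

Definition fresh (a : U) (g : forall b, b ∈ a -> U) (y : U) : Prop :=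
  V kappa y /\ forall b (ba : b ∈ a), g b ba <> y.

Definition least_rank (A : U -> Prop) y : Prop :=
  A y /\ forall z b, A z -> ordinal b -> V b z -> V b y.

Lemma ex_least_rank (A : U -> Prop) : (exists y, A y) -> exists y, least_rank A y.
Proof.
move=> [y Ay]; have [a [oa ya]] := V_rank y.
have [||b [[ob [z [Az zb]]] mb]] := @ex_least U (fun a => ordinal a /\ exists z, A z /\ V a z).
- by exists a; split=> //; exists y.
- by move=> b [].
exists z; split=> // z' b' Az' ob' zb'; apply: V_le zb => //; apply: mb.
by split=> //; exists z'.
Qed.

(** Each ordinal in turn receives an element of least rank among those of V_kappa not yet listed, so
    that V_kappa gets listed in the order of ranks. *)
Definition enum_V : U -> U :=
  Fix (@elem_wf U) (fun _ => U) (fun a g => epsilon (inhabits a) (least_rank (fresh g))).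

Lemma enum_V_eq a :
  enum_V a = epsilon (inhabits a) (least_rank (fresh (fun b (_ : b ∈ a) => enum_V b))).
Proof.
rewrite /enum_V Fix_eq // => x f g fg; congr (epsilon _ (least_rank (fresh _))).
by apply: functional_extensionality_dep => y; apply: functional_extensionality_dep.
Qed.

(** A fresh element exists at stage [a] because V_kappa contains the ordinals below [kappa], and the
    cardinal [kappa] does not inject into [a]. *)
Lemma enum_V_spec a : a ∈ kappa -> least_rank (fresh (fun b (_ : b ∈ a) => enum_V b)) (enum_V a).
Proof.
move=> ak; rewrite enum_V_eq; apply: epsilon_spec; apply: ex_least_rank.
apply: NNPP => nf.
have all y : V kappa y -> exists b, b ∈ a /\ enum_V b = y.
  move=> ky; apply: NNPP => nb; apply: nf; exists y; split=> // b ba e.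
  by apply: nb; exists b.
case: card_kappa => _ /(_ a ak); apply.
pose B x b := b ∈ a /\ enum_V b = x.
pose f x := epsilon (inhabits x) (B x).
have fP x : x ∈ kappa -> B x (f x).
  move=> xk; apply: epsilon_spec; apply: all; apply/V_ord => //; exact: ord_elem xk.
exists f; split=> [x /fP[]//|x y /fP[_ ex] /fP[_ ey] e].
by rewrite -ex -ey e.
Qed.

Lemma enum_V_inj a b : a ∈ kappa -> b ∈ kappa -> enum_V a = enum_V b -> a = b.
Proof.
move=> ak bk e; case: (ord_trich (ord_elem ok ak) (ord_elem ok bk)) => [h|[//|h]].
  by case: (enum_V_spec bk) => [[_ /(_ a h)]].
by case: (enum_V_spec ak) => [[_ /(_ b h)]]; rewrite e.
Qed.

(* Otherwise all the [enum_V a] belong to [V_b] for a least [b], hence are subsets of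
   [enum_V @: c] for some [c < kappa], and are coded by subsets of [c]; a homogeneous
   pair for these codes contradicts injectivity. *)
Lemma enum_V_onto b : b ∈ kappa -> exists2 c, c ∈ kappa &
  forall x, V b x -> exists2 a, a ∈ c & x = enum_V a.
Proof.
elim/elem_ind: b => b ih bk; have ob := ord_elem ok bk.
pose B d c := c ∈ kappa /\ forall x, V d x -> exists2 a, a ∈ c & x = enum_V a.
pose g d := epsilon (inhabits d) (B d).
have gP d : d ∈ b -> B d (g d).
  move=> db; apply: epsilon_spec.
  by have [c] := ih d db (ord_trans ok bk db); exists c.
have [|c ck hc] := @subtle_bound b g bk; first by move=> x /gP[].
have onto x d : d ∈ b -> V d x -> exists2 a, a ∈ c & x = enum_V a.
  move=> db dx; have [_ /(_ x dx)[a ag ->]] := gP d db; exists a => //.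
  by apply: ord_trans (hc _ db) ag; exact: ord_elem ck.
apply: NNPP => nc.
have Vb a : a ∈ kappa -> V b (enum_V a).
  move=> ak; case: (enum_V_spec ak) => _ mn.
  have [z [bz nz]] : exists z, V b z /\ forall b, b ∈ a -> enum_V b <> z.
    apply: NNPP => nz; apply: nc; exists a => // x bx; apply: NNPP => nx.
    by apply: nz; exists x; split=> // d da e; apply: nx; exists d.
  by apply: (mn z) => //; split=> //; apply: V_lt bz.
have [|a [d [/in_sep[ak ca] /in_sep[dk cd] ad h]]] :=
    @subtle_pair (sep kappa (fun a => c ∈ a)) (fun a => sep c (fun x => enum_V x ∈ enum_V a)).
  split.
  - by move=> z /in_sep[].
  - move=> a ak; exists (ssucc (omax a c)); split.
      apply/in_sep; split; first by apply: limit_succ => //; apply: omax_lt.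
      by apply/in_ssucc_ole; apply: omax_r; apply: ord_elem ok _.
    by left; apply/in_ssucc_ole; apply: omax_l; apply: ord_elem ok _.
  - move=> a ak [oa [e ea] _] h; apply/in_sep; split=> //.
    by have [d [/in_sep[_ cd] da _]] := h e ea; apply: ord_trans cd.
have oa := ord_elem ok ak.
have sub x y : V b x -> (forall z, z ∈ c -> enum_V z ∈ x -> enum_V z ∈ y) -> subset x y.
  move=> [e eb ex] hxy z zx; have [w wc ez] := onto _ _ eb (ex _ zx).
  by move: zx; rewrite ez; apply: hxy.
have hE z : z ∈ c -> (enum_V z ∈ enum_V a <-> enum_V z ∈ enum_V d).
  move=> zc; have := h z (ord_trans oa ca zc); rewrite !in_sep; tauto.
have : enum_V a = enum_V d.
  apply: set_ext => z; split; apply: sub => //; try exact: Vb.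
    by move=> w wc /hE; apply.
  by move=> w wc /hE; apply.
move=> /(enum_V_inj ak dk) e; by move: ad; rewrite e => /elem_irr.
Qed.

(** [enum_V_onto] turns a function on a subset [X] of V_b into one on an ordinal below [kappa], with
    value 0 at the indices of sets outside [X]; [subtle_bound] then applies. *)
Lemma subtle_inaccessible : inaccessible kappa.
Proof.
split=> //; first exact: subtle_omega.
move=> X f [b bk hX] fk.
have [c ck hc] := enum_V_onto bk.
pose f' a := if excluded_middle_informative (enum_V a ∈ X) then f (enum_V a) else emptyset.
have [|d dk hd] := @subtle_bound c f' ck.
  move=> x xc; rewrite /f'; case: (excluded_middle_informative (enum_V x ∈ X)) => h; first exact: fk.
  exact: limit0.
exists d => // x xX; have [a ac ex] := hc x (hX x xX).
have := hd a ac; rewrite /f' -ex.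
by case: (excluded_middle_informative (x ∈ X)).
Qed.

(** At a limit [b] closed under this function, V_b is covered by the values of [enum_V] below [b],
    see [onto_limit]. *)
Definition onto_fun b := epsilon (inhabits b) (fun c => c ∈ kappa /\
  forall x, V b x -> exists2 a, a ∈ c & x = enum_V a).

Lemma onto_funP b : b ∈ kappa -> onto_fun b ∈ kappa /\
  forall x, V b x -> exists2 a, a ∈ onto_fun b & x = enum_V a.
Proof.
move=> bk; apply: (epsilon_spec (inhabits b) (fun c => c ∈ kappa /\
  forall x, V b x -> exists2 a, a ∈ c & x = enum_V a)).
by have [c] := enum_V_onto bk; exists c.
Qed.

Lemma onto_limit b : limit b -> b ∈ kappa -> closed_under onto_fun b ->
  forall x, V b x -> exists2 a, a ∈ b & x = enum_V a.
Proof.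
move=> lb bk cb x /(V_limit lb)[d db dx].
have [_ /(_ x dx)[a ad ->]] := onto_funP (ord_trans ok bk db).
by exists a => //; apply: ord_trans (cb _ db) ad; case: lb.
Qed.

Definition singular b : Prop := exists w : U * (U -> U), [/\ w.1 ∈ b,
  forall x, x ∈ w.1 -> w.2 x ∈ b & forall c, c ∈ b -> exists2 x, x ∈ w.1 & ~ w.2 x ∈ c].

(** Given closure under [onto_fun], only regularity remains: a function unbounded on some [X] in V_b
    becomes, through the enumeration, a cofinal map on an ordinal [onto_fun e] below [b]. *)
Lemma nonsingular_inaccessible b : limit b -> omega ∈ b -> b ∈ kappa -> closed_under onto_fun b ->
  ~ singular b -> inaccessible b.
Proof.
move=> lb omb bk cb ns; split=> // X f /(V_limit lb)[d db [e ed hX]] fb.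
have [ob _ _] := lb.
have eb := ord_trans ob db ed.
have [_ onto] := onto_funP (ord_trans ok bk eb).
pose f' a := if excluded_middle_informative (enum_V a ∈ X) then f (enum_V a) else emptyset.
apply: NNPP => nc; apply: ns; exists (onto_fun e, f'); split=> /=; first exact: cb.
  move=> x xc; rewrite /f'; case: (excluded_middle_informative (enum_V x ∈ X)) => h; first exact: fb.
  exact: limit0.
move=> c cb'; apply: NNPP => nx; apply: nc; exists c => // x xX.
have [a ae ex] := onto x (hX x xX).
apply: NNPP => nf; apply: nx; exists a => //.
by rewrite /f' -ex; case: (excluded_middle_informative (x ∈ X)).
Qed.

(** Countably many relations with parameters are reduced to one relation on ordinals: [z] stands for
    the key and the parameters coded by [enum_V z]. As the head of [s] is closed under [onto_fun],
    all codes in its level have an index below it. *)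
Lemma subtle_types (K : Type) (code : K -> nat) (Q : K -> seq U -> seq U -> Prop) F :
  injective code -> closed_under F kappa ->
  exists s, [/\ size s = n.+1, increasing s,
    forall a, List.In a s -> [/\ a ∈ kappa, limit a & closed_under F a] &
    forall k p, (forall x, List.In x p -> V (hd s) x) -> (Q k p (take n s) <-> Q k p (behead s))].
Proof.
move=> code_inj Fk.
have ik := subtle_inaccessible.
have ontok : closed_under onto_fun kappa by move=> b /onto_funP[].
have [G [Gk hG]] := closed_under2 ik Fk ontok.
pose Q' z s := exists k p, enum_V z = code_seq (num (code k) :: p) /\ Q k p s.
have [s [zs ss sc h]] := subtle_sequence Q' (closure_points_club ik Gk).
have sc' a : List.In a s -> [/\ a ∈ kappa, limit a, closed_under F a & closed_under onto_fun a].
  by move=> /sc/in_closure_points[ak la Ga]; have [] := hG a ak la Ga.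
exists s; split=> //; first by move=> a /sc'[].
case: s {ss sc} zs sc' h => [//|a s] zs sc' h k p pV.
have [ak la _ oa] := sc' a (or_introl erefl).
have [|z za ez] := onto_limit la ak oa (x := code_seq (num (code k) :: p)).
  by apply: V_code_seq => // x [<-|/pV//]; exact: V_num.
have := h z za.
have E t : Q' z t <-> Q k p t.
  split; last by exists k, p.
  case=> k' [p' []]; rewrite -ez => /code_seq_inj[/num_inj/code_inj -> ->] //.
by rewrite !E.
Qed.

End Subtle.

(** * Stationary sets of indiscernibles *)

Lemma In_cat (T : Type) (s t : seq T) x : List.In x (s ++ t) <-> List.In x s \/ List.In x t.
Proof. by elim: s => [|y s ih] /=; [intuition|rewrite ih; intuition]. Qed.

Section Types.
Variables (U : universe) (I : Type) (W : I -> seq U -> Prop) (n : nat).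
Implicit Types (a b h x y : U) (s t p : seq U).

(* The two sequences have the same [W]-type over [V_a], as far as their first
   [n] entries are concerned. *)
Definition same_type a s t : Prop := forall i k p, k <= n ->
  (forall x, List.In x p -> V a x) -> (W i (p ++ take k s) <-> W i (p ++ take k t)).

(* By induction on the sequence: its first entry becomes a parameter, the others are
   replaced by entries of [b], and then the first one is replaced. *)
Lemma same_type_cat (X : U -> Prop) (b : seq U) : (forall h, X h -> ordinal h) ->
  (forall h, X h -> same_type h (h :: b) b) ->
  forall s x, increasing (x :: s) -> (forall y, List.In y (x :: s) -> X y) ->
  same_type x (x :: s ++ b) b.
Proof.
move=> oX base; elim=> [|y s ih] x; first by move=> _ h; apply: base; apply: h; left.
move=> [xs ss] Xs i [|k] p kn pV; first by rewrite /= !take0.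
have Xx : X x by apply: Xs; left.
have Xy : X y by apply: Xs; right; left.
have xy : x ∈ y by apply: xs; left.
rewrite -(base x Xx) // /= -!cat_rcons; apply: ih => //.
- by move=> z zs; apply: Xs; right.
- exact: ltnW.
move=> z; rewrite -cats1 In_cat => -[/pV|/= [<-|//]].
  by apply: V_lt => //; exact: oX.
by apply/V_ord => //; exact: oX.
Qed.

End Types.

Section StationaryTypes.
Variables (U : universe) (n : nat) (kappa : U).
Implicit Types (x y z a b c l h : U) (s t p : seq U).
Hypotheses (n_gt0 : 0 < n) (card_kappa : cardinal kappa) (subtle_kappa : subtle n kappa).

Theorem stationary_types (I : Type) (code : I -> nat) (W : I -> seq U -> Prop) F :
  injective code -> closed_under F kappa ->
  exists (b : seq U) h, [/\ size b = n, increasing b,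
    forall a, List.In a b -> [/\ a ∈ kappa, limit a & closed_under F a],
    inaccessible (hd b) /\ stationary (hd b) h &
    forall a, a ∈ h -> [/\ limit a, closed_under F a & same_type W n a (a :: b) b]].
Proof.
move=> code_inj Fk.
have ik : inaccessible kappa by exact: (subtle_inaccessible n_gt0 card_kappa subtle_kappa).
have ok : ordinal kappa by case: card_kappa.
have omk : omega ∈ kappa by case: ik.
have [G [Gk hG]] : exists G, closed_under G kappa /\ forall b, b ∈ kappa -> limit b ->
    closed_under G b -> [/\ closed_under F b, omega ∈ b & closed_under (onto_fun kappa) b].
  have [|G1 [G1k h1]] := closed_under2 ik Fk (G := onto_fun kappa).
    by move=> b /(onto_funP n_gt0 card_kappa subtle_kappa)[].
  have [|G [Gk hG]] := closed_under2 ik G1k (G := fun=> omega); first by [].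
  exists G; split=> // b bk lb /(hG b bk lb)[/(h1 b bk lb)[Fb ob] om]; split=> //.
  by apply: (om emptyset); exact: limit0.
(* [H s] is the candidate stationary set attached to [s], and [D s] a chosen club disjoint from it
   when there is one. *)
pose H s := sep (hd s) (fun a => [/\ limit a, closed_under F a & same_type W n a (a :: s) s]).
pose avoid s c := club (hd s) c /\ forall a, a ∈ c -> ~ a ∈ H s.
pose D s := epsilon (inhabits emptyset) (avoid s).
pose cof b (w : U * (U -> U)) := [/\ w.1 ∈ b,
  forall x, x ∈ w.1 -> w.2 x ∈ b & forall c, c ∈ b -> exists2 x, x ∈ w.1 & ~ w.2 x ∈ c].
pose w b := epsilon (inhabits (b, fun=> b)) (cof b).
pose K := (I * nat + nat)%type.
pose codeK (k : K) : nat := pickle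
  (match k with inl (i, m) => inl (code i, m) | inr m => inr m end : (nat * nat + nat)%type).
have codeK_inj : injective codeK.
  move=> [[i m]|m] [[i' m']|m'] /(pcan_inj (@pickleK _)) // []; last by move=> ->.
  by move=> /code_inj -> ->.
(* The keys [inl] are for the given relations on initial segments, [inr 0] for the existence of a
   disjoint club, [inr 1] for membership in the chosen one, [inr 2] for singularity of the head,
   [inr 3] and the remaining ones for the domain and the graph of a chosen cofinal map. *)
pose Q (k : K) p s := match k with
  | inl (i, m) => m <= n /\ W i (p ++ take m s)
  | inr 0 => exists c, avoid s c
  | inr 1 => hd p ∈ D s
  | inr 2 => singular (hd s)
  | inr 3 => hd p = (w (hd s)).1
  | inr _ => hd (behead p) = (w (hd s)).2 (hd p)
  end.
have [s [zs ss sc hs]] := subtle_types n_gt0 card_kappa subtle_kappa Q codeK_inj Gk.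
have hdt : hd (take n s) = hd s by case: (s) zs (n) n_gt0 => [|a s'] // _ [].
set a0 := hd s in hs hdt; set a1 := hd (behead s).
have [s0 s1] : List.In a0 s /\ List.In a1 s.
  rewrite /a0 /a1; move: zs n_gt0; case: (s) => [|a [|a' s']] //=; last by tauto.
  by case=> <-.
have a01 : a0 ∈ a1.
  rewrite /a0 /a1; move: ss zs n_gt0; case: (s) => [|a [|a' s']] //=.
    by move=> _ [<-].
  by case=> h _ _ _; apply: h; left.
have [a1k l1 G1] := sc _ s1; have [a0k l0 G0] := sc _ s0.
have [F1 om1 on1] := hG _ a1k l1 G1; have [F0 om0 on0] := hG _ a0k l0 G0.
have [o0 _ _] := l0; have [o1 _ _] := l1.
have V0 x : x ∈ a0 -> V a0 x by move=> xa; apply/V_ord => //; exact: ord_elem xa.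
(* The cofinal maps chosen at [a0] and at [a1] have the same domain and the same values, so the
   second one would be bounded by [a0]. *)
have ns : ~ singular a1.
  move=> sg1; have sg0 : singular a0.
    by have := hs (inr 2) [::]; rewrite /Q hdt => h; apply/h.
  have [b0 f0 _] : cof a0 (w a0) by exact: epsilon_spec sg0.
  have [b1 f1 u1] : cof a1 (w a1) by exact: epsilon_spec sg1.
  have e1 : (w a0).1 = (w a1).1.
    have := hs (inr 3) [:: (w a0).1]; rewrite /Q hdt /= => h; apply/h => //.
    by move=> x [<-|//]; exact: V0.
  have [x xb nx] := u1 _ a01; apply: nx; rewrite -e1 in xb.
  have := hs (inr 4) [:: x; (w a0).2 x]; rewrite /Q hdt /= => h.
  rewrite -((h _).1 erefl); first exact: f0.
  move=> y [<-|[<-|//]]; apply: V0; last exact: f0.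
  exact: ord_trans b0 xb.
exists (behead s), (H (behead s)); split.
- by rewrite size_behead zs.
- exact: increasing_behead.
- by move=> a /In_behead/sc[ak la /(hG a ak la)[]].
- split; first by apply: (nonsingular_inaccessible (n := n) (kappa := kappa)).
  split; first by move=> x /in_sep[].
  (* Suppose that [c] misses the set attached to [behead s]. The clubs chosen for [take n s] and
     [behead s] agree below [a0], so the second one contains its limit point [a0]; but equality of
     types puts [a0] into the set attached to [behead s]. *)
  move=> c cc; apply: NNPP => nc.
  have av1 : exists c, avoid (behead s) c.
    by exists c; split=> // a ac aH; apply: nc; exists a.
  have av0 : exists c, avoid (take n s) c.
    by have := hs (inr 0) [::]; rewrite /Q => h; apply/h.
  have [[_ _ cl1] D1] : avoid _ _ := epsilon_spec (inhabits emptyset) _ av1.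
  have [[s0' u0 _] _] : avoid _ _ := epsilon_spec (inhabits emptyset) _ av0.
  rewrite hdt in s0' u0.
  apply: (D1 a0).
    apply: cl1 => // b ba; have [d [dD bd]] := u0 b ba; exists d.
    have da := s0' d dD; split=> //.
    by have := hs (inr 1) [:: d]; rewrite /Q /= => h; apply/h => // x [<-|//]; exact: V0.
  apply/in_sep; split=> //; split=> // i k p kn pV.
  have := hs (inl (i, k)) p pV; rewrite /Q take_takel // => h.
  have e : a0 :: behead s = s by rewrite /a0; case: (s) zs.
  by rewrite e; tauto.
by move=> a /in_sep[_ []].
Qed.

End StationaryTypes.

(** * Formulas and elementary substructures *)

Section FormulaCodes.
Variables (P Q : Type) (codeP : P -> nat) (codeQ : Q -> nat).
Hypotheses (codeP_inj : injective codeP) (codeQ_inj : injective codeQ).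

Fixpoint form_tree n (phi : form P Q n) : GenTree.tree nat :=
  match phi with
  | Mem _ i j => GenTree.Node 0 [:: GenTree.Leaf (i : nat); GenTree.Leaf (j : nat)]
  | Equ _ i j => GenTree.Node 1 [:: GenTree.Leaf (i : nat); GenTree.Leaf (j : nat)]
  | Un _ r i => GenTree.Node 2 [:: GenTree.Leaf (codeP r); GenTree.Leaf (i : nat)]
  | Bin _ r i j =>
    GenTree.Node 3 [:: GenTree.Leaf (codeQ r); GenTree.Leaf (i : nat); GenTree.Leaf (j : nat)]
  | Neg _ f => GenTree.Node 4 [:: form_tree f]
  | And _ f g => GenTree.Node 5 [:: form_tree f; form_tree g]
  | Imp _ f g => GenTree.Node 6 [:: form_tree f; form_tree g]
  | All _ f => GenTree.Node 7 [:: form_tree f]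
  | Ex _ f => GenTree.Node 8 [:: form_tree f]
  end.

Lemma form_tree_inj n : injective (@form_tree n).
Proof.
move=> phi; elim: phi => {n} [n i j|n i j|n r i|n r i j|n f ihf|n f ihf g ihg|n f ihf g ihg|n f ihf|n f ihf] psi.
- by case: psi i j => //= n' i' j' i j [/val_inj-> /val_inj->].
- by case: psi i j => //= n' i' j' i j [/val_inj-> /val_inj->].
- by case: psi i => //= n' r' i' i [/codeP_inj-> /val_inj->].
- by case: psi i j => //= n' r' i' j' i j [/codeQ_inj-> /val_inj-> /val_inj->].
- by case: psi f ihf => //= n' f' f ihf [/ihf->].
- by case: psi f ihf g ihg => //= n' f' g' f ihf g ihg [/ihf-> /ihg->].
- by case: psi f ihf g ihg => //= n' f' g' f ihf g ihg [/ihf-> /ihg->].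
- by case: psi f ihf => //= n' f' f ihf [/ihf->].
- by case: psi f ihf => //= n' f' f ihf [/ihf->].
Qed.

(** The tree keeps variables as bare numbers, so the number of free variables is recorded beside
    it. *)
Definition form_code (phi : {n & form P Q n}) : nat :=
  pickle (projT1 phi, form_tree (projT2 phi)).

Lemma form_code_inj : injective form_code.
Proof.
move=> [n phi] [m psi] /(pcan_inj (@pickleK _)) /= [e].
by move: phi; rewrite e => phi /form_tree_inj ->.
Qed.

End FormulaCodes.

Lemma scons0 T n (x : T) (e : 'I_n -> T) : scons x e ord0 = x.
Proof. by rewrite /scons unlift_none. Qed.

Lemma scons_lift T n (x : T) (e : 'I_n -> T) i : scons x e (lift ord0 i) = e i.
Proof. by rewrite /scons liftK. Qed.

Lemma scons_shift T n (x : T) (e : 'I_n -> T) : (fun i => scons x e (lift ord0 i)) = e.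
Proof. by apply: functional_extensionality => i; rewrite scons_lift. Qed.

Lemma scons_eta T n (e : 'I_n.+1 -> T) : scons (e ord0) (fun i => e (lift ord0 i)) = e.
Proof.
apply: functional_extensionality => i.
by case: (unliftP ord0 i) => [j ->|->]; rewrite ?scons0 ?scons_lift.
Qed.

Lemma scons_comp T n m (e : 'I_m.+1 -> T) (s : 'I_n -> 'I_m) :
  scons (e ord0) (fun j => e (lift ord0 (s j))) =
  (fun j => e (scons ord0 (fun i => lift ord0 (s i)) j)).
Proof.
apply: functional_extensionality => i.
by case: (unliftP ord0 i) => [j ->|->]; rewrite ?scons0 ?scons_lift.
Qed.

Section Elementarity.
Variables (U : universe) (P Q : Type).
Implicit Types (M N : U -> Prop) (p : P -> U -> Prop) (q : Q -> U -> U -> Prop).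

Lemma sat_ext M p p' q q' : (forall r x, M x -> (p r x <-> p' r x)) ->
  (forall r x y, M x -> M y -> (q r x y <-> q' r x y)) ->
  forall n (phi : form P Q n) e, (forall i, M (e i)) ->
    (sat (@elem U) M p q phi e <-> sat (@elem U) M p' q' phi e).
Proof.
move=> hp hq n phi; elim: phi => {n} [n i j|n i j|n r i|n r i j|n f ihf|n f ihf g ihg|n f ihf g ihg|n f ihf|n f ihf] e eM //=.
- exact: hp.
- exact: hq.
- by rewrite ihf.
- by rewrite ihf // ihg.
- by rewrite ihf // ihg.
- have cM x : M x -> forall i, M (scons x e i).
    by move=> Mx i; case: (unliftP ord0 i) => [j ->|->]; rewrite ?scons0 ?scons_lift.
  by split=> h x Mx; apply/ihf; [exact: cM|exact: h|exact: cM|exact: h].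
- have cM x : M x -> forall i, M (scons x e i).
    by move=> Mx i; case: (unliftP ord0 i) => [j ->|->]; rewrite ?scons0 ?scons_lift.
  by split=> -[x [Mx h]]; exists x; split=> //; apply/ihf => //; exact: cM.
Qed.

Definition elementary p q M N : Prop := forall n (phi : form P Q n) e, (forall i, M (e i)) ->
  (sat (@elem U) M p q phi e <-> sat (@elem U) N p q phi e).

Lemma tarski_vaught p q M N : (forall x, M x -> N x) ->
  (forall n (phi : form P Q n.+1) e, (forall i, M (e i)) ->
    (exists x, N x /\ sat (@elem U) N p q phi (scons x e)) ->
    exists x, M x /\ sat (@elem U) N p q phi (scons x e)) ->
  elementary p q M N.
Proof.
move=> s tv n phi; elim: phi => {n} [n i j|n i j|n r i|n r i j|n f ihf|n f ihf g ihg|n f ihf g ihg|n f ihf|n f ihf] e eM //=.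
- by rewrite ihf.
- by rewrite ihf // ihg.
- by rewrite ihf // ihg.
- have cM x : M x -> forall i, M (scons x e i).
    by move=> Mx i; case: (unliftP ord0 i) => [j ->|->]; rewrite ?scons0 ?scons_lift.
  split=> h x Mx; last by apply/ihf; [exact: cM|apply/h/s].
  apply: NNPP => nh; have [|y [My ny]] := tv n (Neg f) e eM; first by exists x.
  by apply: ny; apply/ihf; [exact: cM|exact: h].
- have cM x : M x -> forall i, M (scons x e i).
    by move=> Mx i; case: (unliftP ord0 i) => [j ->|->]; rewrite ?scons0 ?scons_lift.
  split=> [[x [Mx h]]|]; first by exists x; split; [exact: s|apply/ihf => //; exact: cM].
  by move=> /(tv n f e eM)[x [Mx h]]; exists x; split=> //; apply/ihf => //; exact: cM.
Qed.

End Elementarity.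

Section ElementaryClub.
Variables (U : universe) (P Q : Type) (codeP : P -> nat) (codeQ : Q -> nat).
Hypotheses (codeP_inj : injective codeP) (codeQ_inj : injective codeQ).
Variables (l : U) (p : P -> U -> Prop) (q : Q -> U -> U -> Prop).
Hypothesis il : inaccessible l.

Definition env_of n (s : seq U) : 'I_n -> U := fun i => nth emptyset s i.

Lemma V_env_bound b n (e : 'I_n -> U) : limit b -> (forall i, V b (e i)) ->
  exists2 a, a ∈ b & forall i, V a (e i).
Proof.
move=> lb; have [ob _ _] := lb.
elim: n e => [|n ih] e eb; first by exists emptyset; [exact: limit0|case].
have [|a ab ha] := ih (fun i => e (lift ord0 i)); first by move=> i; exact: eb.
have [c cb hc] := V_limit lb (eb ord0).
have [oa oc] := (ord_elem ob ab, ord_elem ob cb).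
exists (omax a c); first exact: omax_lt.
move=> i; case: (unliftP ord0 i) => [j ->|->].
  by apply: V_le (ha j); [exact: ord_max2|exact: omax_l].
by apply: V_le hc; [exact: ord_max2|exact: omax_r].
Qed.

(** [F a] bounds the ranks of Skolem witnesses for all formulas with parameters in V_a. At a limit
    closure point, finitely many parameters lie in some V_a with [a] smaller, and the Tarski-Vaught
    test applies. *)
Lemma elementary_club : exists F, closed_under F l /\
  forall b, b ∈ l -> limit b -> closed_under F b -> elementary p q (V b) (V l).
Proof.
have [ll oml bnd] := il; have [ol _ _] := ll.
pose holds k s x := exists phi : {n & form P Q n.+1},
  k = form_code codeP codeQ (existT (form P Q) (projT1 phi).+1 (projT2 phi)) /\
  sat (@elem U) (V l) p q (projT2 phi) (scons x (env_of s)).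
pose wit z c := c ∈ l /\ forall k s, z = code_seq (num k :: s) ->
  (exists x, V l x /\ holds k s x) -> exists x, V c x /\ holds k s x.
pose f z := epsilon (inhabits z) (wit z).
have fP z : wit z (f z).
  apply: epsilon_spec.
  case: (classic (exists k s, z = code_seq (num k :: s) /\ exists x, V l x /\ holds k s x)).
    move=> [k [s [ez [x [lx hx]]]]]; have [c cl cx] := V_limit ll lx.
    exists c; split=> // k' s'; rewrite ez => /code_seq_inj[/num_inj <- <-] _.
    by exists x.
  move=> nz; exists emptyset; split; first exact: limit0.
  by move=> k s ez h; case: nz; exists k, s.
pose B a c := c ∈ l /\ forall k s, (forall x, List.In x s -> V a x) ->
  (exists x, V l x /\ holds k s x) -> exists x, V c x /\ holds k s x.
pose F a := epsilon (inhabits a) (B a).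
have FP a : a ∈ l -> B a (F a).
  move=> al; apply: epsilon_spec.
  (* The level at a limit [d] above [a] is a set containing the codes of all formulas with
     parameters in V_a, so inaccessibility bounds all the witnesses at once. *)
  have [|d [/in_closure_points[dl ld _] ad]] := @closure_points_unbounded _ l il id a _ al; first by [].
  have [||c cl hc] := bnd (Vset d) f.
  - exact: V_Vset.
  - by move=> x _; case: (fP x).
  have [oc od _] := And3 (ord_elem ol cl) (ord_elem ol dl) I.
  exists c; split=> // k s sa h.
  have Vz : code_seq (num k :: s) ∈ Vset d.
    apply/in_Vset; apply: V_code_seq => // x [<-|/sa]; first exact: V_num.
    exact: V_lt.
  have [_ /(_ k s erefl h)[x [fx hx]]] := fP (code_seq (num k :: s)).
  by exists x; split=> //; apply: V_lt (hc _ Vz) fx.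
exists F; split=> [a /FP[]//|b bl lb Fb].
have [ob _ _] := lb.
apply: tarski_vaught => [x|n phi e eb [x [lx hx]]]; first exact: V_lt.
have [a ab ha] := V_env_bound lb eb.
pose s := [seq e i | i <- enum 'I_n].
have es : env_of s = e.
  apply: functional_extensionality => i.
  by rewrite /env_of (nth_map i) ?size_enum_ord // nth_ord_enum.
have [_ /(_ (form_code codeP codeQ (existT _ n.+1 phi)) s)[]] := FP a (ord_trans ol bl ab).
- move=> y; rewrite /s; elim: (enum 'I_n) => //= i r ih [<-|/ih//]; exact: ha.
- by exists x; split=> //; exists (existT _ n phi); rewrite /= es.
move=> y [Fy [[n' phi'] /= [/(form_code_inj codeP_inj codeQ_inj) ephi hy]]].
exists y; split; first by apply: V_lt (Fb _ ab) Fy.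
have [en] := f_equal (@projT1 _ _) ephi; subst n'.
have -> := Eqdep_dec.inj_pair2_eq_dec _ (fun x y => decP (x =P y :> nat)) _ _ _ _ ephi.
by rewrite -es.
Qed.

End ElementaryClub.

(** * Definable predicates of the structure V_l *)

Section Definability.
Variables (U : universe) (P Q : Type) (l : U).
Variables (p : P -> U -> Prop) (q : Q -> U -> U -> Prop).
Hypothesis ll : limit l.
Implicit Types (x y z a b c : U).

Let ol : ordinal l. Proof. by case: ll. Qed.
Notation M := (V l).
Notation sat := (@sat U (@elem U) P Q M p q).

(** Parameter-free definability in V_l. A notion is shown definable by rewriting it so that the
    closure lemmas below apply, in place of displaying its formula. *)
Definition dfn m (A : ('I_m -> U) -> Prop) : Prop :=
  exists phi : form P Q m, forall e, (forall i, M (e i)) -> (sat phi e <-> A e).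

Lemma V_scons m x (e : 'I_m -> U) : M x -> (forall i, M (e i)) -> forall i, M (scons x e i).
Proof.
by move=> Mx eM i; case: (unliftP ord0 i) => [j ->|->]; rewrite ?scons0 ?scons_lift.
Qed.

Lemma dfn_iff m (A B : ('I_m -> U) -> Prop) :
  (forall e, (forall i, M (e i)) -> (A e <-> B e)) -> dfn A -> dfn B.
Proof. by move=> h [phi hphi]; exists phi => e eM; rewrite hphi // h. Qed.

Lemma dfn_mem m (i j : 'I_m) : dfn (fun e => e i ∈ e j).
Proof. by exists (Mem i j). Qed.

Lemma dfn_equ m (i j : 'I_m) : dfn (fun e => e i = e j).
Proof. by exists (Equ i j). Qed.

Lemma dfn_un m r (i : 'I_m) : dfn (fun e => p r (e i)).
Proof. by exists (Un r i). Qed.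

Lemma dfn_bin m r (i j : 'I_m) : dfn (fun e => q r (e i) (e j)).
Proof. by exists (Bin r i j). Qed.

Lemma dfn_not m (A : ('I_m -> U) -> Prop) : dfn A -> dfn (fun e => ~ A e).
Proof. by move=> [f hf]; exists (Neg f) => e eM /=; rewrite hf. Qed.

Lemma dfn_and m (A B : ('I_m -> U) -> Prop) : dfn A -> dfn B -> dfn (fun e => A e /\ B e).
Proof. by move=> [f hf] [g hg]; exists (And f g) => e eM /=; rewrite hf // hg. Qed.

Lemma dfn_imp m (A B : ('I_m -> U) -> Prop) : dfn A -> dfn B -> dfn (fun e => A e -> B e).
Proof. by move=> [f hf] [g hg]; exists (Imp f g) => e eM /=; rewrite hf // hg. Qed.

Lemma dfn_equiv m (A B : ('I_m -> U) -> Prop) : dfn A -> dfn B -> dfn (fun e => A e <-> B e).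
Proof. by move=> hA hB; apply: dfn_and; apply: dfn_imp. Qed.

Lemma dfn_or m (A B : ('I_m -> U) -> Prop) : dfn A -> dfn B -> dfn (fun e => A e \/ B e).
Proof.
move=> hA hB; apply: dfn_iff (dfn_imp (dfn_not hA) hB) => e _; tauto.
Qed.

Lemma dfn_all m (A : U -> ('I_m -> U) -> Prop) :
  dfn (fun e : 'I_m.+1 -> U => A (e ord0) (fun i => e (lift ord0 i))) ->
  dfn (fun e => forall x, M x -> A x e).
Proof.
move=> [f hf]; exists (All f) => e eM /=.
have E x (Mx : M x) := hf _ (V_scons Mx eM).
by split=> h x Mx; move: (h x Mx); rewrite (E x Mx) scons_shift scons0.
Qed.

Lemma dfn_ex m (A : U -> ('I_m -> U) -> Prop) :
  dfn (fun e : 'I_m.+1 -> U => A (e ord0) (fun i => e (lift ord0 i))) ->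
  dfn (fun e => exists x, M x /\ A x e).
Proof.
move=> [f hf]; exists (Ex f) => e eM /=.
have E x (Mx : M x) := hf _ (V_scons Mx eM).
by split=> -[x [Mx h]]; exists x; split=> //; move: h; rewrite (E x Mx) scons_shift scons0.
Qed.

Lemma dfn_all_in m (A : U -> ('I_m -> U) -> Prop) i :
  dfn (fun e : 'I_m.+1 -> U => A (e ord0) (fun i => e (lift ord0 i))) ->
  dfn (fun e => forall x, x ∈ e i -> A x e).
Proof.
move=> h; apply: (@dfn_iff _ (fun e => forall x, M x -> x ∈ e i -> A x e)).
  move=> e eM; split=> hx x; last by move=> _; exact: hx.
  by move=> xe; apply: hx => //; apply: V_trans xe.
by apply: dfn_all; apply: dfn_imp => //; apply: dfn_mem.
Qed.

Lemma dfn_ex_in m (A : U -> ('I_m -> U) -> Prop) i :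
  dfn (fun e : 'I_m.+1 -> U => A (e ord0) (fun i => e (lift ord0 i))) ->
  dfn (fun e => exists x, x ∈ e i /\ A x e).
Proof.
move=> h; apply: (@dfn_iff _ (fun e => exists x, M x /\ x ∈ e i /\ A x e)).
  move=> e eM; split; first by case=> x [_ hx]; exists x.
  by case=> x [xe hx]; exists x; split=> //; apply: V_trans xe.
by apply: dfn_ex; apply: dfn_and => //; apply: dfn_mem.
Qed.

Lemma dfn_True m : dfn (fun _ : 'I_m -> U => True).
Proof.
apply: (@dfn_iff _ (fun _ => forall x, M x -> x = x)); first by [].
by apply: dfn_all; apply: dfn_equ.
Qed.

Ltac dfn_step := cbv beta; first
  [ apply: dfn_mem | apply: dfn_equ | apply: dfn_and | apply: dfn_or | apply: dfn_not
  | apply: dfn_all_in | apply: dfn_ex_in | apply: dfn_equiv | apply: dfn_all | apply: dfn_ex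
  | apply: dfn_imp | apply: dfn_True ].

Lemma dfn_subset m (i j : 'I_m) : dfn (fun e => subset (e i) (e j)).
Proof. by rewrite /subset; repeat dfn_step. Qed.

Lemma dfn_ordinal m (i : 'I_m) : dfn (fun e => ordinal (e i)).
Proof.
apply: (@dfn_iff _ (fun e => (forall x, x ∈ e i -> subset x (e i)) /\
  (forall x, x ∈ e i -> forall y, y ∈ x -> subset y x))).
  by move=> e _; split=> -[h1 h2]; split=> // x y xe; exact: (h2 x).
by rewrite /subset; repeat dfn_step.
Qed.

Lemma dfn_ole m (i j : 'I_m) : dfn (fun e => ole (e i) (e j)).
Proof. by rewrite /ole; repeat dfn_step. Qed.

Lemma dfn_limit m (i : 'I_m) : dfn (fun e => limit (e i)).
Proof.
apply: (@dfn_iff _ (fun e => ordinal (e i) /\ (exists b, b ∈ e i /\ True) /\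
  forall b, b ∈ e i -> exists c, c ∈ e i /\ b ∈ c)).
  move=> e _; split; first by case=> oe [[b [be _]] h]; split=> //; exists b.
  by case=> oe [b be] h; split=> //; split=> //; exists b.
by apply: dfn_and; [exact: dfn_ordinal|repeat dfn_step].
Qed.

Lemma dfn_upair m (i j k : 'I_m) : dfn (fun e => e i = upair (e j) (e k)).
Proof.
apply: (@dfn_iff _ (fun e => e j ∈ e i /\ e k ∈ e i /\
  forall z, z ∈ e i -> z = e j \/ z = e k)).
  move=> e _; split.
    move=> [h1 [h2 h3]]; apply: set_ext => z; rewrite in_upair; split=> [/h3//|].
    by case=> ->.
  move=> ->; split; first by apply/in_upair; left.
  by split; [apply/in_upair; right|move=> z /in_upair].
by repeat dfn_step.
Qed.

Lemma dfn_opair m (i j k : 'I_m) : dfn (fun e => e i = opair (e j) (e k)).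
Proof.
apply: (@dfn_iff _ (fun e => exists u, u ∈ e i /\ exists v, v ∈ e i /\
  u = upair (e j) (e j) /\ v = upair (e j) (e k) /\ e i = upair u v)).
  move=> e _; split; first by move=> [u [_ [v [_ [-> [-> ->]]]]]].
  move=> ->; exists (upair (e j) (e j)); split; first by apply/in_upair; left.
  by exists (upair (e j) (e k)); split=> //; apply/in_upair; right.
do 2!apply: dfn_ex_in; cbv beta.
by apply: dfn_and; [exact: dfn_upair|apply: dfn_and; exact: dfn_upair].
Qed.

Lemma dfn_opair_mem m (i j k : 'I_m) : dfn (fun e => opair (e j) (e k) ∈ e i).
Proof.
apply: (@dfn_iff _ (fun e => exists u, u ∈ e i /\ u = opair (e j) (e k))).
  by move=> e _; split=> [[u [ui <-]]//|h]; exists (opair (e j) (e k)).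
by apply: dfn_ex_in; exact: dfn_opair.
Qed.

Definition prod_set x y : U :=
  sep (power (power (union2 x y))) (fun z => exists a b, [/\ a ∈ x, b ∈ y & z = opair a b]).

Lemma in_prod_set x y z : z ∈ prod_set x y <-> exists a b, [/\ a ∈ x, b ∈ y & z = opair a b].
Proof.
rewrite in_sep; split=> [[]//|h]; split=> //.
have [a [b [ax bY ->]]] := h; apply/in_power => w /in_upair hw; apply/in_power => v.
by case: hw => -> /in_upair[]->; apply/in_union2; [left|left|left|right].
Qed.

Lemma V_prod x y : M x -> M y -> M (prod_set x y).
Proof.
move=> Mx My; apply: (@V_subset _ _ (power (power (union2 x y)))); last by move=> z /in_sep[].
by do 2!apply: V_power => //; apply: V_Union => //; apply: V_upair.
Qed.

(* A relation [g] witnesses [V a x] if it relates [x] to some [b] in [a] and, whenever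
   it relates [y] to [b], every element of [y] to some element of [b]. *)
Lemma V_witness a x : M a -> M x -> (V a x <-> exists g, M g /\
  (exists b, b ∈ a /\ opair x b ∈ g) /\
  forall u, u ∈ g -> forall y, M y -> forall b, M b -> u = opair y b ->
    forall z, z ∈ y -> exists c, c ∈ b /\ opair z c ∈ g).
Proof.
move=> Ma Mx; split; last first.
  move=> [g [Mg [[b [ba xg]] hg]]]; exists b => // z zx.
  have Mb : M b by apply: V_trans Ma ba.
  elim/elem_ind: x b {ba Ma} Mx Mb xg z zx => x ih b Mx Mb xg z zx.
  have [c [cb zg]] := hg _ xg x Mx b Mb erefl z zx.
  exists c => // y yz; apply: (ih z) zg y yz => //; [exact: V_trans zx|exact: V_trans cb].
move=> [b ba hx].
have [d dl [da dx]] : exists2 d, d ∈ l & V d a /\ V d x.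
  have [d1 d1l ad] := V_limit ll Ma; have [d2 d2l xd] := V_limit ll Mx.
  have [o1 o2] := (ord_elem ol d1l, ord_elem ol d2l).
  exists (omax d1 d2); first exact: omax_lt.
  by split; [apply: V_le ad; [exact: ord_max2|exact: omax_l]|
             apply: V_le xd; [exact: ord_max2|exact: omax_r]].
have od := ord_elem ol dl.
pose g := sep (prod_set (Vset d) (Vset d)) (fun u => exists y b, u = opair y b /\ forall z, z ∈ y -> V b z).
exists g; split.
  apply: V_subset (_ : M (prod_set (Vset d) (Vset d))) _; last by move=> u /in_sep[].
  by apply: V_prod; exact: V_Vset.
split.
  exists b; split=> //; apply/in_sep; split; last by exists x, b.
  apply/in_prod_set; exists x, b; split=> //; apply/in_Vset => //; exact: V_trans ba.
move=> u /in_sep[/in_prod_set[y' [b' [/in_Vset yd /in_Vset bd ->]]]].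
move=> [y2 [b2 [/opair_inj[<- <-] hy]]] y _ c _ /opair_inj[<- <-] z zy.
have [e eb hz] := hy z zy; exists e; split=> //; apply/in_sep; split; last by exists z, e.
apply/in_prod_set; exists z, e; split=> //; apply/in_Vset; [exact: V_trans zy|exact: V_trans eb].
Qed.

Lemma dfn_V m (i j : 'I_m) : dfn (fun e => V (e i) (e j)).
Proof.
apply: (dfn_iff (A := fun e => exists g, M g /\
  (exists b, b ∈ e i /\ opair (e j) b ∈ g) /\
  forall u, u ∈ g -> forall y, M y -> forall b, M b -> u = opair y b ->
    forall z, z ∈ y -> exists c, c ∈ b /\ opair z c ∈ g)).
  by move=> e eM; rewrite V_witness.
apply: dfn_ex; apply: dfn_and; first by apply: dfn_ex_in; apply: dfn_opair_mem.
apply: dfn_all_in; do 2!apply: dfn_all; apply: dfn_imp; first exact: dfn_opair.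
by apply: dfn_all_in; apply: dfn_ex_in; exact: dfn_opair_mem.
Qed.

Lemma V_into a x : M a -> V a x -> M x.
Proof.
suff h k : ordinal k -> forall a x, V k a -> V a x -> V k x by exact: h.
elim/elem_ind: k => k ih ok a' x' [d dk ad] [b ba hx].
by exists d => // y /hx; apply: ih => //; [exact: ord_elem dk|exact: ad].
Qed.

(** Truth of one fixed formula in V_a is definable with [a] as a variable: its quantifiers are
    relativized by means of [dfn_V]. *)
Lemma dfn_relativized k (phi : form P Q k) m (s : 'I_k -> 'I_m) (i : 'I_m) :
  dfn (fun e => Defs.sat (@elem U) (V (e i)) p q phi (fun j => e (s j))).
Proof.
elim: phi m s i => {k} [k j j'|k j j'|k r j|k r j j'|k f ihf|k f ihf g ihg|k f ihf g ihg|k f ihf|k f ihf] m s i /=.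
- exact: dfn_mem.
- exact: dfn_equ.
- exact: dfn_un.
- exact: dfn_bin.
- exact/dfn_not/ihf.
- by apply: dfn_and; [exact: ihf|exact: ihg].
- by apply: dfn_imp; [exact: ihf|exact: ihg].
- apply: (dfn_iff (A := fun e => forall x, M x -> V (e i) x ->
      Defs.sat (@elem U) (V (e i)) p q f (scons x (fun j => e (s j))))).
    by move=> e eM; split=> h x; [move=> Vx; apply: h => //; exact: V_into Vx|move=> _; exact: h].
  apply: dfn_all; apply: dfn_imp; first exact: dfn_V.
  apply: dfn_iff (ihf m.+1 (scons ord0 (fun j => lift ord0 (s j))) (lift ord0 i)) => e _.
  by rewrite scons_comp.
- apply: (dfn_iff (A := fun e => exists x, M x /\ V (e i) x /\
      Defs.sat (@elem U) (V (e i)) p q f (scons x (fun j => e (s j))))).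
    move=> e eM; split=> [[x [_ hx]]|[x [Vx hx]]]; exists x => //.
    by split=> //; exact: V_into Vx.
  apply: dfn_ex; apply: dfn_and; first exact: dfn_V.
  apply: dfn_iff (ihf m.+1 (scons ord0 (fun j => lift ord0 (s j))) (lift ord0 i)) => e _.
  by rewrite scons_comp.
Qed.

(** A renaming of variables, obtained semantically rather than by syntactic substitution. *)
Lemma dfn_sat k (phi : form P Q k) m (s : 'I_k -> 'I_m) : dfn (fun e => sat phi (fun j => e (s j))).
Proof.
elim: phi m s => {k} [k j j'|k j j'|k r j|k r j j'|k f ihf|k f ihf g ihg|k f ihf g ihg|k f ihf|k f ihf] m s /=.
- exact: dfn_mem.
- exact: dfn_equ.
- exact: dfn_un.
- exact: dfn_bin.
- exact/dfn_not/ihf.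
- by apply: dfn_and; [exact: ihf|exact: ihg].
- by apply: dfn_imp; [exact: ihf|exact: ihg].
- apply: dfn_all.
  apply: dfn_iff (ihf m.+1 (scons ord0 (fun j => lift ord0 (s j)))) => e _.
  by rewrite scons_comp.
- apply: dfn_ex.
  apply: dfn_iff (ihf m.+1 (scons ord0 (fun j => lift ord0 (s j)))) => e _.
  by rewrite scons_comp.
Qed.

Lemma dfn_fin k m (A : 'I_k -> ('I_m -> U) -> Prop) : (forall j, dfn (A j)) ->
  dfn (fun e => forall j, A j e).
Proof.
elim: k A => [|k ih] A h; first by apply: dfn_iff (dfn_True _) => e _; split=> // _ [].
apply: dfn_iff (dfn_and (h ord0) (ih _ (fun j => h (lift ord0 j)))) => e _; split; last by split.
by move=> [h0 h1] j; case: (unliftP ord0 j) => [j' ->|->].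
Qed.

Lemma dfn_all_env k m (A : ('I_k -> U) -> ('I_m -> U) -> Prop) :
  dfn (fun e : 'I_(k + m) -> U => A (fun i => e (lshift m i)) (fun i => e (rshift k i))) ->
  dfn (fun e => forall f, (forall i, M (f i)) -> A f e).
Proof.
elim: k A => [|k ih] A h.
  apply: dfn_iff h => e _.
  have -> : (fun i => e (rshift 0 i)) = e.
    by apply: functional_extensionality => i; congr e; apply: val_inj.
  split=> [h f _|h]; last by apply: h => -[].
  by rewrite (_ : f = (fun i => e (lshift m i))) //; apply: functional_extensionality => -[].
apply: (dfn_iff (A := fun e => forall f, (forall i, M (f i)) -> forall x, M x -> A (scons x f) e)).
  move=> e _; split=> hA f fM; last by move=> x Mx; apply: hA; exact: V_scons.
  by rewrite -(scons_eta f); apply: hA.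
apply: ih; apply: dfn_all; apply: dfn_iff h => e _.
rewrite (_ : (fun i => e (lshift m i)) = scons (e ord0) (fun i => e (lift ord0 (lshift m i)))); last first.
  apply: functional_extensionality => i; case: (unliftP ord0 i) => [j ->|->].
    by rewrite scons_lift; congr e; apply: val_inj.
  by rewrite scons0; congr e; apply: val_inj.
by rewrite (_ : (fun i => e (rshift k.+1 i)) = (fun i => e (lift ord0 (rshift k i)))) //;
  apply: functional_extensionality => i; congr e; apply: val_inj.
Qed.

(** Reflection of one formula between V_a and V_l becomes a definable property of [a], and so can be
    transferred between ordinals of the same type. *)
Lemma dfn_reflects k (phi : form P Q k) m (i : 'I_m) :
  dfn (fun e => forall f, (forall j, V (e i) (f j)) ->
    (Defs.sat (@elem U) (V (e i)) p q phi f <-> sat phi f)).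
Proof.
apply: (dfn_iff (A := fun e => forall f, (forall j, M (f j)) -> (forall j, V (e i) (f j)) ->
    (Defs.sat (@elem U) (V (e i)) p q phi f <-> sat phi f))).
  move=> e eM; split=> h f fM; last by move=> fV; exact: h.
  by apply: h => // j; apply: V_into (fM j).
apply: dfn_all_env; apply: dfn_imp.
  by apply: dfn_fin => j; exact: dfn_V.
by apply: dfn_equiv; [exact: dfn_relativized|exact: dfn_sat].
Qed.

End Definability.

(** * Definability of finite size, cardinals, clubs, ineffability and indescribability *)

Section HasSize.
Variable U : universe.
Implicit Types (x y z a b c h : U).

Lemma has_size0 x : has_size 0 x <-> forall z, ~ z ∈ x.
Proof.
split=> [[e [_ h]] z /h[[]]//|h]; exists (fun=> x); split; first by case.
by move=> z; split=> [/h|[[]]].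
Qed.

(** This recursion on [m] removes the metatheoretic enumeration from [has_size], which makes it
    expressible by a formula. *)
Lemma has_sizeS m x :
  has_size m.+1 x <-> exists y, y ∈ x /\ has_size m (sep x (fun z => z <> y)).
Proof.
split.
  move=> [e [inj_e h]]; exists (e ord0); split; first by apply/h; exists ord0.
  exists (fun i => e (lift ord0 i)); split; first by move=> i j /inj_e/lift_inj.
  move=> z; rewrite in_sep h; split; last first.
    by case=> i ->; split; [exists (lift ord0 i)|move/inj_e/esym/eqP; rewrite (negbTE (neq_lift _ _))].
  by case=> -[i ->]; case: (unliftP ord0 i) => [j ->|->] // _; exists j.
move=> [y [yx [e [inj_e h]]]]; exists (scons y e).
have ey i : e i <> y by have /in_sep[] : e i ∈ sep x (fun z => z <> y) by apply/h; exists i.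
split.
  move=> i j; case: (unliftP ord0 i) => [i' ->|->]; case: (unliftP ord0 j) => [j' ->|->];
    rewrite ?scons0 ?scons_lift //; [by move/inj_e->|by move/ey|by move/esym/ey].
move=> z; split.
  move=> zx; case: (classic (z = y)) => [->|zy]; first by exists ord0; rewrite scons0.
  have [/(_ (proj2 (in_sep _ _ _) (conj zx zy)))[i ->] _] := h z.
  by exists (lift ord0 i); rewrite scons_lift.
case=> i ->; case: (unliftP ord0 i) => [j ->|->]; rewrite ?scons0 ?scons_lift //.
by have /in_sep[] : e j ∈ sep x (fun z => z <> y) by apply/h; exists j.
Qed.

Lemma has_size_nonempty m x : 0 < m -> has_size m x -> exists z, z ∈ x.
Proof. by case: m => // m _ /has_sizeS[y [yx _]]; exists y. Qed.

End HasSize.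

Section DefinableNotions.
Variables (U : universe) (P Q : Type) (l : U).
Variables (p : P -> U -> Prop) (q : Q -> U -> U -> Prop).
Hypothesis ll : limit l.
Implicit Types (x y z a b c : U).

Let ol : ordinal l. Proof. by case: ll. Qed.
Notation M := (V l).
Notation dfn := (@dfn U P Q l p q _).

Ltac dfn_step := cbv beta; first
  [ apply: dfn_mem | apply: dfn_equ | apply: dfn_opair_mem | apply: dfn_ordinal
  | apply: dfn_subset | apply: dfn_limit | apply: dfn_ole
  | apply: dfn_and | apply: dfn_or | apply: dfn_not
  | apply: dfn_all_in | apply: dfn_ex_in | apply: dfn_equiv | apply: dfn_all | apply: dfn_ex
  | apply: dfn_imp | apply: dfn_True ]; try exact: ll.

(** Metatheoretic functions are replaced by relations that are elements of V_l: one passes to the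
    graph in one direction and chooses values in the other. *)
Lemma dfn_cardinal m (i : 'I_m) : dfn (fun e => cardinal (e i)).
Proof.
apply: (dfn_iff (A := fun e => ordinal (e i) /\ forall b, b ∈ e i ->
  ~ exists r, M r /\ ((forall x, x ∈ e i -> exists y, y ∈ b /\ opair x y ∈ r) /\
    forall x, x ∈ e i -> forall x', x' ∈ e i -> forall y, y ∈ b ->
      opair x y ∈ r -> opair x' y ∈ r -> x = x'))); last by repeat dfn_step.
move=> e eM; split=> -[oe h]; split=> // b be.
  move=> [f [fb fi]]; apply: (h b be).
  exists (sep (prod_set (e i) b) (fun u => exists x, u = opair x (f x))); split.
    apply: V_subset (_ : M (prod_set (e i) b)) _; last by move=> u /in_sep[].
    by apply: V_prod => //; apply: V_trans be.
  split=> [x xe|x xe x' x'e y _].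
    exists (f x); split; first exact: fb.
    by apply/in_sep; split; [apply/in_prod_set; exists x, (f x); split=> //; exact: fb|exists x].
  move=> /in_sep[_ [x1 /opair_inj[<- ey]]] /in_sep[_ [x2 /opair_inj[<- ey']]].
  by apply: fi => //; rewrite -ey.
move=> [r [_ [h1 h2]]]; apply: (h b be).
pose f x := epsilon (inhabits x) (fun y => y ∈ b /\ opair x y ∈ r).
have fP x : x ∈ e i -> f x ∈ b /\ opair x (f x) ∈ r.
  by move=> /h1; apply: (epsilon_spec (inhabits x) (fun y => y ∈ b /\ opair x y ∈ r)).
exists f; split=> [x /fP[]//|x x' xe x'e ef].
have [[fb h3] [_ h4]] := (fP x xe, fP x' x'e); rewrite -ef in h4.
exact: h2 fb h3 h4.
Qed.

Lemma dfn_has_size k m (i : 'I_m) : dfn (fun e => has_size k (e i)).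
Proof.
elim: k m i => [|k ih] m i.
  apply: (dfn_iff (A := fun e => forall z, z ∈ e i -> ~ True)); last by repeat dfn_step.
  by move=> e _; rewrite has_size0; split=> h z => [/h|/h].
apply: (dfn_iff (A := fun e => exists y, y ∈ e i /\ exists x, M x /\ has_size k x /\
  (forall z, z ∈ x -> z ∈ e i /\ ~ z = y) /\ forall z, z ∈ e i -> ~ z = y -> z ∈ x)).
  move=> e eM; rewrite has_sizeS; split=> -[y [ye]].
    move=> [x [_ [hx [h1 h2]]]]; exists y; split=> //.
    have -> // : sep (e i) (fun z => z <> y) = x.
    by apply: set_ext => z; rewrite in_sep; split=> [[]|]; [exact: h2|exact: h1].
  move=> hs; exists y; split=> //; exists (sep (e i) (fun z => z <> y)).
  split; first by apply: V_subset (eM i) _ => z /in_sep[].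
  split=> //; split=> z; first by move=> /in_sep.
  by move=> ze zy; apply/in_sep.
apply: dfn_ex_in => //; apply: dfn_ex; apply: dfn_and; first exact: ih.
by repeat dfn_step.
Qed.

Lemma dfn_club m (i j : 'I_m) : dfn (fun e => club (e i) (e j)).
Proof.
apply: (dfn_iff (A := fun e => subset (e j) (e i) /\
  (forall a, a ∈ e i -> exists b, b ∈ e j /\ ole a b) /\
  forall a, a ∈ e i -> limit a ->
    (forall b, b ∈ a -> exists d, d ∈ e j /\ (d ∈ a /\ ole b d)) -> a ∈ e j));
  last by repeat dfn_step.
move=> e _; split.
  move=> [h1 [h2 h3]]; split=> // a ae la h; apply: h3 => // b /h[d [? ? ?]].
  by exists d.
move=> [h1 h2 h3]; split=> //; split=> // a ae la h; apply: h3 => // b /h[d [? [? ?]]].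
by exists d.
Qed.

(** A regressive [f] is coded by the set [r] of the pairs of [x] and [z] with [z] in [f x], a subset
    of the product of [power a] and [a], hence an element of V_l as [l] is a limit. Positivity of
    [k] provides the minima. *)
Lemma dfn_ineffable k m (i : 'I_m) : 0 < k -> dfn (fun e => ineffable k (e i)).
Proof.
move=> k_gt0.
apply: (dfn_iff (A := fun e => ordinal (e i) /\ forall r, M r ->
  (forall x, M x -> subset x (e i) -> has_size k x -> forall b, b ∈ x ->
    forall z, z ∈ e i -> opair x z ∈ r -> z ∈ b) ->
  exists h, M h /\ ((subset h (e i) /\ forall c, M c -> club (e i) c -> exists b, b ∈ h /\ b ∈ c) /\
    forall x, M x -> subset x h -> has_size k x -> forall y, M y -> subset y h -> has_size k y ->
      forall z, z ∈ e i -> (forall b, b ∈ x -> z ∈ b) -> (forall b, b ∈ y -> z ∈ b) ->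
      (opair x z ∈ r <-> opair y z ∈ r)))); last first.
  by repeat first [exact: dfn_has_size|exact: dfn_club|dfn_step].
move=> e eM; move: (e i) (eM i) => a Ma; clear e eM i m.
split=> -[oa ha]; split=> //.
- move=> f rf.
  pose r := sep (prod_set (power a) a) (fun u => exists x z, u = opair x z /\ z ∈ f x).
  have rE x z : subset x a -> z ∈ a -> (opair x z ∈ r <-> z ∈ f x).
    move=> xa za; rewrite in_sep; split; first by move=> [_ [x' [z' [/opair_inj[-> ->]]]]].
    move=> zf; split; last by exists x, z.
    by apply/in_prod_set; exists x, z; split=> //; apply/in_power.
  have [||h [Mh [[ha' sth] hom]]] := ha r.
  + apply: V_subset (_ : M (prod_set (power a) a)) _; last by move=> u /in_sep[].
    by apply: V_prod => //; apply: V_power.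
  + move=> x Mx xa sx b bx z za /rE h.
    have [||d [dx md]] := @ex_least U (fun z => z ∈ x).
    * exact: has_size_nonempty sx.
    * by move=> c /xa/(ord_elem oa).
    have zd : z ∈ d by apply: (rf x d) => //; exact: h.
    by apply: ole_subset (md b bx) _ zd; apply: ord_elem oa _; exact: xa.
  exists h; split.
    split=> // c cc; apply: sth => //; have [ca _ _] := cc; exact: V_subset ca.
  move=> x y c [xh sx] [yh sy] [hc mc] z zc.
  have xa : subset x a by move=> w /xh/ha'.
  have ya : subset y a by move=> w /yh/ha'.
  have ca : c ∈ a by case: hc => [/xa|/ya].
  have za : z ∈ a by apply: ord_trans ca zc.
  have zb b : b ∈ x \/ b ∈ y -> z ∈ b.
    move=> hb; apply: ole_subset (mc b hb) _ zc; apply: ord_elem oa _.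
    by case: hb => [/xa|/ya].
  rewrite -!rE //; apply: hom => //; try exact: V_subset Ma _.
  + by move=> b bx; apply: zb; left.
  + by move=> b bY; apply: zb; right.
- move=> r Mr reg; pose f x := sep a (fun z => opair x z ∈ r).
  have [|h [[ha' sth] hom]] := ha f.
    move=> x b [xa sx] [bx _] z /in_sep[za xz].
    by apply: (reg x) xz => //; exact: V_subset xa.
  exists h; split; first exact: V_subset ha'.
  split; first by split=> // c _; exact: sth.
  move=> x _ xh sx y _ yh sy z za zx zy.
  have [||c lc] := @ex_least U (fun z => z ∈ x \/ z ∈ y).
  + by have [w wx] := has_size_nonempty k_gt0 sx; exists w; left.
  + by move=> w [/xh|/yh] /ha'/(ord_elem oa).
  have zc : z ∈ c by case: lc => -[cx|cy] _; [exact: zx|exact: zy].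
  have := hom x y c (conj xh sx) (conj yh sy) lc z zc.
  by rewrite !in_sep; tauto.
Qed.

Lemma dfn_sat_set k (phi : form_set k) m (s : 'I_k -> 'I_m) :
  dfn (fun e => sat_set (@elem U) M phi (fun j => e (s j))).
Proof.
rewrite /sat_set.
elim: phi m s => {k} [k j j'|k j j'|k []|k []|k f ihf|k f ihf g ihg|k f ihf g ihg|k f ihf|k f ihf] m s /=.
- exact: dfn_mem.
- exact: dfn_equ.
- exact/dfn_not/ihf.
- by apply: dfn_and; [exact: ihf|exact: ihg].
- by apply: dfn_imp; [exact: ihf|exact: ihg].
- apply: dfn_all.
  apply: dfn_iff (ihf m.+1 (scons ord0 (fun j => lift ord0 (s j)))) => e _.
  by rewrite scons_comp.
- apply: dfn_ex.
  apply: dfn_iff (ihf m.+1 (scons ord0 (fun j => lift ord0 (s j)))) => e _.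
  by rewrite scons_comp.
Qed.

(** One formula at a time, so that each instance is definable and can be transferred. *)
Definition indescribable (phi : form_set 2) a : Prop := forall A, subset A a ->
  sat_set (@elem U) M phi (env2 a A) ->
  exists nu B, [/\ nu ∈ a, forall z, z ∈ B <-> z ∈ A /\ z ∈ nu &
    sat_set (@elem U) M phi (env2 nu B)].

Lemma env2_comp m (e : 'I_m -> U) i j : env2 (e i) (e j) = (fun k => e (env2 i j k)).
Proof.
apply: functional_extensionality => k; rewrite /env2.
by case: (unliftP ord0 k) => [k' ->|->]; rewrite ?scons0 ?scons_lift.
Qed.

Lemma dfn_indescribable phi m (i : 'I_m) : dfn (fun e => indescribable phi (e i)).
Proof.
have dfn2 m' (j k : 'I_m') : dfn (fun e => sat_set (@elem U) M phi (env2 (e j) (e k))).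
  by apply: dfn_iff (dfn_sat_set phi (env2 j k)) => e _; rewrite env2_comp.
apply: (dfn_iff (A := fun e => forall A, M A -> subset A (e i) ->
  sat_set (@elem U) M phi (env2 (e i) A) -> exists nu, nu ∈ e i /\ exists B, M B /\
  (((forall z, z ∈ B -> z ∈ A /\ z ∈ nu) /\ forall z, z ∈ A -> z ∈ nu -> z ∈ B) /\
   sat_set (@elem U) M phi (env2 nu B)))); last first.
  by repeat first [exact: dfn2|dfn_step].
move=> e eM; split=> h A => [Ae sA|MA Ae sA].
  have [|nu [nue [B [_ [[h1 h2] sB]]]]] := h A _ Ae sA; first exact: V_subset Ae.
  by exists nu, B; split=> // z; split=> [/h1//|[]]; exact: h2.
have [nu [B [nue hB sB]]] := h A Ae sA; exists nu; split=> //; exists B; split.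
  by apply: V_subset MA _ => z /hB[].
by split=> //; split=> z; rewrite hB.
Qed.

End DefinableNotions.

(** * The axioms of ZFC in V_l *)

Lemma inaccessible_zfc (U : universe) (l : U) : inaccessible l -> models_zfc (@elem U) (V l).
Proof.
move=> [ll oml bnd]; have [ol _ _] := ll.
have tr x z : V l x -> z ∈ x -> V l z by move=> lx; apply: V_trans.
split.
- by move=> x y lx ly h; apply: set_ext => z; split=> zx; apply/h => //; apply: tr zx.
- move=> x lx [y [_ yx]]; have [|z [zx h]] := @foundation U x; first by exists y.
  by exists z; split=> //; exact: tr zx.
- by move=> x y lx ly; exists (upair x y); split; [exact: V_upair|move=> z _; exact: in_upair].
- move=> x lx; exists (Union x); split; first exact: V_Union.
  move=> z _; rewrite in_Union; split=> [[y [yx zy]]|[y [_ yx zy]]]; exists y => //.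
  by split=> //; apply: tr yx.
- move=> x lx; exists (power x); split; first exact: V_power.
  move=> z lz; rewrite in_power; split=> h w; first by move=> _; apply: h.
  by move=> wz; apply: h => //; apply: tr wz.
- exists omega; split.
  + by apply/V_ord => //; exact: ord_omega.
  + exists emptyset; split; [exact: V_num 0|by apply/in_omega; exists 0|by move=> w _ /in_emptyset].
  + move=> y _ /in_omega[m ->]; exists (num m.+1).
    by split; [exact: V_num|apply/in_omega; exists m.+1|move=> z _; exact: in_ssucc].
- move=> A _ x lx; exists (sep x A); split; last by move=> z _; exact: in_sep.
  by apply: V_subset lx _ => z /in_sep[].
- move=> F _ Ffun x lx.
  pose rk z r := r ∈ l /\ forall w, V l w -> F z w -> V r w.
  pose g z := epsilon (inhabits z) (rk z).
  have gP z : z ∈ x -> rk z (g z).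
    move=> zx; apply: epsilon_spec.
    case: (classic (exists w, V l w /\ F z w)) => [[w [lw Fw]]|nw].
      have [r rl rw] := V_limit ll lw; exists r; split=> // w' lw' Fw'.
      by rewrite (Ffun z w' w) //; apply: tr zx.
    by exists emptyset; split=> [|w lw Fw]; [exact: limit0|case: nw; exists w].
  have [|c cl hc] := bnd x g lx; first by move=> z /gP[].
  have oc := ord_elem ol cl.
  exists (sep (Vset c) (fun w => V l w /\ exists z, z ∈ x /\ F z w)); split.
    by apply: V_subset (V_Vset ol cl) _ => w /in_sep[].
  move=> w lw; rewrite in_sep; split.
    by move=> [_ [_ [z [zx Fw]]]]; exists z; split=> //; apply: tr zx.
  move=> [z [_ zx Fw]]; split; last by split=> //; exists z.
  by apply/in_Vset; apply: V_lt (hc z zx) _ => //; have [_] := gP z zx; apply.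
- move=> x lx ne disj.
  pose f (y : U) := epsilon (inhabits y) (fun z => z ∈ y).
  have fP y : y ∈ x -> f y ∈ y.
    move=> yx; apply: (epsilon_spec (inhabits y) (fun z => z ∈ y)).
    by have [|z [_ zy]] := ne y _ yx; [exact: tr yx|exists z].
  exists (fimage f x); split.
    apply: V_subset (V_Union ll lx) _ => z /in_fimage[y [yx ->]].
    by apply/in_Union; exists y; split=> //; exact: fP.
  move=> y ly yx; exists (f y); split.
  + by apply: tr (fP y yx).
  + exact: fP.
  + by apply/in_fimage; exists y.
  move=> z lz zy /in_fimage[y' [y'x ez]]; rewrite ez; congr f.
  apply: (disj y' y z) => //; [exact: tr y'x|by rewrite ez; exact: fP].
Qed.

(** * Weakly reflective ordinals *)

Section Lists.
Variable U : universe.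

Definition list_of m (s : 'I_m -> U) : seq U := [seq s i | i <- enum 'I_m].

Lemma size_list_of m (s : 'I_m -> U) : size (list_of s) = m.
Proof. by rewrite size_map size_enum_ord. Qed.

Lemma nth_list_of m (s : 'I_m -> U) (i : 'I_m) : nth emptyset (list_of s) i = s i.
Proof. by rewrite (nth_map i) ?size_enum_ord // nth_ord_enum. Qed.

Lemma In_list_of m (s : 'I_m -> U) x : List.In x (list_of s) <-> exists i, x = s i.
Proof.
rewrite In_nth size_list_of; split=> [[i im ->]|[i ->]].
  by exists (Ordinal im); rewrite -(nth_list_of s (Ordinal im)).
by exists (val i); [exact: ltn_ord|rewrite nth_list_of].
Qed.

Lemma increasingP (s : seq U) :
  (forall i j, i < j -> j < size s -> nth emptyset s i ∈ nth emptyset s j) -> increasing s.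
Proof.
elim: s => [|x s ih] h //=; split.
  by move=> y /In_nth[i si ->]; apply: (h 0 i.+1).
by apply: ih => i j ij js; apply: (h i.+1 j.+1).
Qed.

Lemma V_env_of l (s : seq U) n : limit l -> (forall x, List.In x s -> V l x) ->
  forall i : 'I_n, V l (env_of s i).
Proof.
move=> ll h i; rewrite /env_of; case: (ltnP i (size s)) => si.
  by apply: h; apply/In_nth; exists i.
by rewrite nth_default //; exact: (V_num ll 0).
Qed.

Lemma sat_rename P Q (l : U) (p : P -> U -> Prop) (q : Q -> U -> U -> Prop) k m
    (E1 E2 : 'I_k -> U) (e1 e2 : 'I_m -> U) : limit l ->
  (forall i, V l (e1 i)) -> (forall i, V l (e2 i)) ->
  (forall i, exists j, E1 i = e1 j /\ E2 i = e2 j) ->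
  (forall psi : form P Q m, sat (@elem U) (V l) p q psi e1 <-> sat (@elem U) (V l) p q psi e2) ->
  forall phi : form P Q k, sat (@elem U) (V l) p q phi E1 <-> sat (@elem U) (V l) p q phi E2.
Proof.
move=> ll e1l e2l h he phi.
have [s hs] := ClassicalEpsilon.choice (fun i j => E1 i = e1 j /\ E2 i = e2 j) h.
have -> : E1 = fun i => e1 (s i) by apply: functional_extensionality => i; case: (hs i).
have -> : E2 = fun i => e2 (s i) by apply: functional_extensionality => i; case: (hs i).
have [psi hpsi] := dfn_sat l p q phi s.
by rewrite -hpsi // -hpsi.
Qed.

End Lists.

Section WeaklyReflective.
Variables (U : universe) (n : nat) (kappa lambda : U) (b : seq U) (h : U).
Implicit Types (x y z a c : U) (s t p : seq U).

(** The truth predicate of V_kappa for all formulas at once; the condition on the length fits the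
    sequence to the arity. *)
Definition set_types (phi : {m & form_set m}) s : Prop :=
  size s = projT1 phi /\ sat_set (@elem U) (V kappa) (projT2 phi) (env_of s).

Hypotheses (n_gt0 : 0 < n) (lk : limit kappa) (il : inaccessible lambda).
Hypotheses (lambda_kappa : lambda ∈ kappa) (sb : size b = n) (hdb : hd b = lambda).
Hypothesis lambda_elem : elementary_substructure (V lambda) (V kappa).
Hypothesis lambda_ineffable : 1 < n -> ineffable n.-1 lambda.
Hypothesis lambda_indescribable : forall phi, indescribable kappa phi lambda.
Hypothesis sth : stationary lambda h.
Hypothesis htypes : forall a, a ∈ h -> same_type set_types n a (a :: b) b.

Let ok : ordinal kappa. Proof. by case: lk. Qed.
Let ll : limit lambda. Proof. by case: il. Qed.
Let ol : ordinal lambda. Proof. by case: ll. Qed.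

Definition weakly_reflective a : Prop := a ∈ lambda /\ same_type set_types n a (a :: b) b.
Local Notation R := weakly_reflective.

Lemma weakly_reflective_ord a : R a -> ordinal a.
Proof. by case=> /(ord_elem ol). Qed.

Lemma stationary_weakly_reflective a : a ∈ h -> R a.
Proof. by move=> ah; split; [case: sth => + _; exact|exact: htypes]. Qed.

(** Types of length one compare [a] with the head [lambda] of [b], so that properties definable in
    V_kappa without parameters pass between them. *)
Lemma same_type_transfer (D : U -> Prop) a : same_type set_types n a (a :: b) b -> a ∈ kappa ->
  (forall m (i : 'I_m), dfn kappa (@of_void (U -> Prop)) (@of_void (U -> U -> Prop)) (fun e => D (e i))) ->
  D a <-> D lambda.
Proof.
move=> ta ak /(_ 1 ord0)[phi hphi].
have := ta (existT _ 1 phi) 1 [::] n_gt0; rewrite /set_types /= take0.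
have -> : take 1 b = [:: lambda].
  by move: hdb n_gt0; rewrite -sb; case: (b) => //= x s ->; rewrite take0.
have V1 x : x ∈ kappa -> forall i : 'I_1, V kappa (env_of [:: x] i).
  by move=> xk; apply: V_env_of => // y [<-|//]; apply/V_ord => //; exact: ord_elem xk.
have := hphi _ (V1 _ ak); have := hphi _ (V1 _ lambda_kappa); rewrite /sat_set /env_of /=.
move=> h1 h2 /(_ (fun _ f => match f with end)) h3; tauto.
Qed.

Lemma weakly_reflective_elementary a : R a -> elementary_substructure (V a) (V kappa).
Proof.
move=> [al ta]; have ak := ord_trans ok lambda_kappa al.
split=> [x|k phi]; first exact: V_lt.
pose D x := forall f : 'I_k -> U, (forall j, V x (f j)) ->
  (sat_set (@elem U) (V x) phi f <-> sat_set (@elem U) (V kappa) phi f).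
apply: (proj2 (same_type_transfer (D := D) ta ak _)); last first.
  by case: lambda_elem => _; apply.
by move=> m i; exact: dfn_reflects.
Qed.

Lemma same_type_seq x s : increasing (x :: s) -> (forall y, List.In y (x :: s) -> R y) ->
  same_type set_types n x (x :: s ++ b) b.
Proof.
apply: (same_type_cat (X := R)) => y [yl ty] //; exact: ord_elem yl.
Qed.

Lemma weakly_reflective_unbounded c : c ∈ lambda -> exists2 a, a ∈ h & c ∈ a.
Proof.
move=> cl; have [|a [ah al la Fa]] := stationary_closure_point il sth (F := fun=> c).
  by [].
by exists a => //; apply: (Fa emptyset); exact: limit0.
Qed.

Lemma sat_set_types x s t m (phi : form_set m) p : same_type set_types n x s t ->
  n <= size s -> n <= size t -> size p + n = m ->
  (forall y, List.In y p -> V x y) ->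
  (sat_set (@elem U) (V kappa) phi (env_of (p ++ take n s)) <->
   sat_set (@elem U) (V kappa) phi (env_of (p ++ take n t))).
Proof.
move=> ty ns nt pm pV; have := ty (existT _ m phi) n p (leqnn n) pV.
rewrite /set_types /= !size_cat !size_takel // pm; tauto.
Qed.

Lemma V_weakly_reflective a : R a -> V kappa a.
Proof.
move=> [al _]; apply/V_ord => //; first exact: ord_elem al.
exact: ord_trans al.
Qed.

(** Both compared tuples consist of weakly reflective ordinals, so by [same_type_seq] each has over
    V_a the type of [b]. These types are computed in V_kappa, in which the level at the last entry
    of [alpha] is elementary. *)
Lemma weakly_reflective_same_theory a (alpha : 'I_n.+1 -> U) : R a ->
  (forall i, R (alpha i)) -> ole a (alpha ord0) ->
  (forall i j : 'I_n.+1, i < j -> alpha i ∈ alpha j) -> same_theory a alpha.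
Proof.
move=> Ra Ralpha aa inc m phi s sV.
have oa := weakly_reflective_ord Ra; have oal i := weakly_reflective_ord (Ralpha i).
have [sub el] := weakly_reflective_elementary (Ralpha ord_max).
have a0m : alpha ord0 ∈ alpha ord_max by exact: inc.
have am : a ∈ alpha ord_max by apply: ole_lt_trans a0m.
have sVm i : V (alpha ord_max) (s i) by apply: V_lt (sV i) => //.
have rV x : x ∈ alpha ord_max -> forall i : 'I_n, replace_first x alpha i ∈ alpha ord_max.
  move=> xm i; rewrite /replace_first; case: ifP => // _; apply: inc => /=; exact: ltn_ord.
have eV x : ordinal x -> x ∈ alpha ord_max -> forall i, V (alpha ord_max) (cat_env (replace_first x alpha) s i).
  move=> ox xm i; rewrite /cat_env; case: (split i) => j //.
  have hj := rV x xm j; by apply/V_ord => //; exact: ord_elem hj.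
rewrite el; last exact: eV.
rewrite el; last exact: eV.
pose L x := list_of (replace_first x alpha).
have szL x : size (L x) = n by exact: size_list_of.
have key x : R x -> ole a x -> ole x (alpha ord0) -> forall psi : form_set (m + n),
    sat_set (@elem U) (V kappa) psi (env_of (list_of s ++ L x)) <->
    sat_set (@elem U) (V kappa) psi (env_of (list_of s ++ take n b)).
  move=> Rx ax xa psi; have ox := weakly_reflective_ord Rx.
  have incL : increasing (L x).
    apply: increasingP => i j ij; rewrite szL => jn.
    have i_n := ltn_trans ij jn.
    rewrite (nth_list_of _ (Ordinal i_n)) (nth_list_of _ (Ordinal jn)) /replace_first /=.
    have -> : (j == 0) = false by case: (j) ij.
    case: ifP => [_|_]; last exact: inc.
    by apply: ole_lt_trans xa _ => //; apply: inc => /=; exact: leq_ltn_trans ij.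
  have RL y : List.In y (L x) -> R y.
    by move=> /In_list_of[i ->]; rewrite /replace_first; case: ifP.
  have hdL : L x = x :: behead (L x).
    have := nth_list_of (replace_first x alpha) (Ordinal n_gt0); rewrite -/(L x) /=.
    have := szL x; case: (L x) => [/= n0|y t _ /= -> //]; exfalso.
    by move: n_gt0; rewrite -n0.
  have ty : same_type set_types n x (L x ++ b) b.
    by rewrite hdL; apply: same_type_seq; rewrite -hdL.
  have eL : take n (L x ++ b) = L x.
    by rewrite takel_cat ?szL // -[in LHS](szL x) take_size.
  rewrite -[in env_of (_ ++ L x)]eL; apply: (sat_set_types psi ty).
  - by rewrite size_cat szL leq_addr.
  - by rewrite sb.
  - by rewrite size_list_of.
  by move=> y /In_list_of[i ->]; apply: V_le (sV i).
have Vk y : R y -> V kappa y by exact: V_weakly_reflective.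
have envV x : R x -> forall i : 'I_(m + n), V kappa (env_of (list_of s ++ L x) i).
  move=> Rx; apply: V_env_of => // y /In_cat[/In_list_of[i ->]|/In_list_of[i ->]].
    by apply: sub.
  by rewrite /replace_first; case: ifP => _; exact: Vk.
(* Only the order differs: [cat_env] puts the parameters last, the types put them first. *)
apply: (@sat_rename U void void kappa _ _ (n + m) (m + n) _ _
  (env_of (list_of s ++ L a)) (env_of (list_of s ++ L (alpha ord0)))) => //.
- exact: envV.
- exact: envV.
- have nthL x (i : 'I_(n + m)) : cat_env (replace_first x alpha) s i =
      env_of (list_of s ++ L x) (match split i with inl j => rshift m j | inr j => lshift n j end).
    rewrite /cat_env /env_of; case: (split i) => j /=; rewrite nth_cat size_list_of.
      by rewrite ltnNge leq_addr /= addKn nth_list_of.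
    by rewrite ltn_ord nth_list_of.
  by move=> i; eexists; split; exact: nthL.
move=> psi; rewrite -!/(sat_set _ _ _ _) key //; last exact: ole_refl.
rewrite key //; exact: ole_refl.
Qed.

(** The hypothesis is applied to members u_0 < ... < u_n of [h] above [a]. The sequence [a :: b] has
    over V_a the type of (a, u_1, u_2, ...), because the ordinals after [a] can be replaced with [a]
    as a parameter in V_(u_1). By hypothesis this is the type of (u_0, u_1, ...), which is that of
    [b]. *)
Lemma weakly_reflective_of_same_theory a : V lambda a -> ordinal a ->
  (forall alpha : 'I_n.+1 -> U, (forall i, V lambda (alpha i) /\ R (alpha i)) ->
    ole a (alpha ord0) -> (forall i j : 'I_n.+1, i < j -> alpha i ∈ alpha j) ->
    same_theory a alpha) -> R a.
Proof.
move=> Va oa ha.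
have al : a ∈ lambda by apply/(V_ord ol oa).
pose B c x := x ∈ h /\ c ∈ x.
pose nx c := epsilon (inhabits c) (B c).
have nxP c : c ∈ lambda -> B c (nx c).
  by move=> /weakly_reflective_unbounded[x xh cx]; apply: epsilon_spec; exists x.
have [hl _] := sth.
pose u m := iter m nx (nx a).
have uh m : u m ∈ h by elim: m => [|m ih]; [case: (nxP a al)|case: (nxP _ (hl _ ih))].
have ul m := hl _ (uh m); have ou m := ord_elem ol (ul m).
have uS m : u m ∈ u m.+1 by case: (nxP _ (ul m)).
have ult i j : i < j -> u i ∈ u j.
  elim: j => // j ih; rewrite ltnS leq_eqVlt => /orP[/eqP->//|/ih h']; exact: ord_trans h'.
have au : a ∈ u 0 by case: (nxP a al).
have Ru m := stationary_weakly_reflective (uh m).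
pose alpha (i : 'I_n.+1) := u i.
have th : same_theory a alpha.
  apply: ha => [i||i j ij]; [|by left|exact: ult].
  by split; [apply/(V_ord ol (ou i))|exact: Ru].
split=> // -[m phi] k p kn pV.
case: k kn => [|k] kn; first by rewrite !take0.
pose T := [seq u i.+1 | i <- iota 0 n].
have szT : size T = n by rewrite size_map size_iota.
have nthT i : i < n -> nth emptyset T i = u i.+1.
  by move=> i_n; rewrite (nth_map 0) ?size_iota // nth_iota.
have InT x : List.In x T -> exists i, x = u i.+1.
  by move=> /In_nth[i iT ->]; exists i; apply: nthT; rewrite -szT.
have incT : increasing T.
  apply: increasingP => i j ij; rewrite szT => jn; rewrite !nthT //; first exact: ult.
  exact: ltn_trans jn.
have hT : T = u 1 :: behead T.
  by rewrite /T; case: (n) n_gt0.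
have tT : same_type set_types n (u 1) (T ++ b) b.
  rewrite hT; apply: same_type_seq; rewrite -hT //.
  by move=> y /InT[i ->].
have tT0 : same_type set_types n (u 0) (u 0 :: T ++ b) b.
  apply: same_type_seq; first by split=> // y /InT[i ->]; exact: ult.
  by move=> y [<-//|/InT[i ->]].
have o1 := ou 1; have o0 := ou 0.
have kn' : k <= n by exact: ltnW.
have takeT k' : k' <= n -> take k' (T ++ b) = take k' T by move=> ?; rewrite takel_cat ?szT.
have -> : set_types (existT _ m phi) (p ++ take k.+1 (a :: b)) <->
    set_types (existT _ m phi) (p ++ a :: take k T).
  rewrite /= -!cat_rcons -takeT // (tT _ _ _ kn') // => y.
  rewrite -cats1 In_cat => -[/pV py|/= [<-|//]].
    by apply: V_lt py => //; apply: ord_trans (uS 0) au.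
  by apply/V_ord => //; apply: ord_trans (uS 0) au.
rewrite -(tT0 _ _ _ kn); last by move=> y /pV py; apply: V_lt py.
rewrite /= takeT // /set_types /= !size_cat /=.
suff E : size p + (size (take k T)).+1 = m ->
    sat_set (@elem U) (V kappa) phi (env_of (p ++ a :: take k T)) <->
    sat_set (@elem U) (V kappa) phi (env_of (p ++ u 0 :: take k T)) by tauto.
rewrite size_takel ?szT // => em.
have [sub el] := weakly_reflective_elementary (Ru n).
pose s (i : 'I_(size p)) := nth emptyset p i.
have sV i : V a (s i) by apply: pV; apply/In_nth; exists (val i); first exact: ltn_ord.
have un i : i < n -> u i ∈ u n by exact: ult.
have aun : a ∈ u n by apply: ord_trans (un 0 _) au => //; exact: ou.
have eV x : ordinal x -> x ∈ u n -> forall i, V (u n) (cat_env (replace_first x alpha) s i).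
  move=> ox xn i; rewrite /cat_env; case: (split i) => j; last by apply: V_lt (sV j).
  rewrite /replace_first; case: ifP => _; first exact/(V_ord (ou n) ox).
  by apply/(V_ord (ou n) (ou _)); apply: un => /=; exact: ltn_ord.
have ek x (psi : form_set (n + size p)) : ordinal x -> x ∈ u n ->
    sat_set (@elem U) (V (u n)) psi (cat_env (replace_first x alpha) s) <->
    sat_set (@elem U) (V kappa) psi (cat_env (replace_first x alpha) s).
  by move=> ox xn; apply: el; exact: eV.
apply: (@sat_rename U void void kappa _ _ m (n + size p) _ _
  (cat_env (replace_first a alpha) s) (cat_env (replace_first (u 0) alpha) s)) => //.
- by move=> i; apply: sub; apply: eV.
- by move=> i; apply: sub; apply: eV => //; apply: un.
- move=> i; rewrite /env_of !nth_cat; case: (ltnP i (size p)) => ip.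
    by exists (rshift n (Ordinal ip)); rewrite /cat_env (unsplitK (inr _)).
  have jn : i - size p < n.
    by rewrite ltn_subLR //; apply: leq_trans (ltn_ord i) _; rewrite -em leq_add2l.
  exists (lshift (size p) (Ordinal jn)); rewrite /cat_env (unsplitK (inl _)) /replace_first /=.
  move: jn; case E : (i - size p) => [|j] jn //=.
  have jk : j < k.
    by have := ltn_ord i; rewrite -{2}em -(subnKC ip) E ltn_add2l.
  by rewrite nth_take // nthT //; exact: ltn_trans jn.
move=> psi; rewrite -!/(sat_set _ _ _ _) -!ek //.
  exact: th.
exact: un.
Qed.

Theorem weakly_reflective_model : exists R : U -> Prop,
  [/\ forall a, R a -> a ∈ lambda, weakly_reflective_axioms lambda R n &
    forall a, R a -> (1 < n -> ineffable n.-1 a) /\ fully_indescribable lambda a].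
Proof.
exists R; split; first by move=> a [].
- split.
  + exact: inaccessible_zfc.
  + move=> x lx; exists (sep x R); split; last by move=> z _; exact: in_sep.
    by apply: V_subset lx _ => z /in_sep[].
  + by move=> a _; exact: weakly_reflective_ord.
  + move=> psi.
    (* For A6, stationarity gives a member [a] of [h] such that V_a is elementary in V_lambda with
       the predicate [R]. *)
    have [F [Fl hF]] := elementary_club (codeP := fun _ : unit => 0) (codeQ := of_void nat)
      ltac:(by case=> [[]]) ltac:(by case) (fun=> R) (@of_void (U -> U -> Prop)) il.
    have [a [ah al la Fa]] := stationary_closure_point il sth Fl.
    exists a; split; [by apply/V_ord => //; exact: ord_elem al|exact: stationary_weakly_reflective|].
    by move=> s sa; rewrite /sat_un (hF a).
  + move=> a Va oa; split.
      by move=> Ra alpha hal; apply: weakly_reflective_same_theory => // i; case: (hal i).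
    exact: weakly_reflective_of_same_theory.
- move=> a Ra; have [al ta] := Ra; have ak := ord_trans ok lambda_kappa al.
  split.
    move=> n1; apply/(same_type_transfer ta ak); last exact: lambda_ineffable.
    by move=> m i; apply: dfn_ineffable => //; case: (n) n1 => // -[].
  split=> //.
    apply/(same_type_transfer ta ak); last by case: (inaccessible_regular il).
    by move=> m i; exact: dfn_cardinal.
  have Va : V lambda a by apply/V_ord => //; exact: weakly_reflective_ord.
  have [sub el] := lambda_elem.
  have elE x y phi : V lambda x -> V lambda y ->
      sat_set (@elem U) (V lambda) phi (env2 x y) <-> sat_set (@elem U) (V kappa) phi (env2 x y).
    move=> lx ly; apply: el => i; rewrite /env2.
    by case: (unliftP ord0 i) => [j ->|->]; rewrite ?scons0 ?scons_lift.
  move=> phi A Aa; have VA : V lambda A by apply: V_subset Va Aa.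
  rewrite elE // => sA.
  have ia : indescribable kappa phi a.
    apply/(same_type_transfer ta ak); last exact: lambda_indescribable.
    by move=> m i; exact: dfn_indescribable.
  have [nu [B [nua hB sB]]] := ia A Aa sA; exists nu, B; split=> //.
  rewrite elE //; first by apply: V_trans Va nua.
  by apply: V_subset VA _ => z /hB[].
Qed.

End WeaklyReflective.

(** * Reflective ordinals *)

Lemma V_env2 (U : universe) (l a x : U) : V l a -> V l x -> forall i, V l (env2 a x i).
Proof.
by move=> la lx i; rewrite /env2; case: (unliftP ord0 i) => [j ->|->]; rewrite ?scons0 ?scons_lift.
Qed.

Definition regular_uncountable (U : universe) (a : U) : Prop := regular a /\ uncountable_cardinal a.

(** At level 1 theories are compared with that of V_kappa equipped with this predicate, whence the
    need for elementarity in the expanded language. *)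
Lemma regular_uncountable_elementary_club (U : universe) (l : U) : inaccessible l ->
  exists F, closed_under F l /\ forall b, b ∈ l -> limit b -> closed_under F b ->
    elementary (fun _ : unit => @regular_uncountable U) (@of_void (U -> U -> Prop)) (V b) (V l).
Proof.
by apply: (elementary_club (codeP := fun _ : unit => 0) (codeQ := of_void nat)); [case=> [[]]|case].
Qed.

Section Reflective.
Variables (U : universe) (n : nat) (kappa lambda : U) (b : seq U) (h : U).
Implicit Types (x y z a c : U) (s t p : seq U).

Local Notation elem_un R := (elementary (fun _ : unit => R) (@of_void (U -> U -> Prop))).

(* The [k]-reflective ordinals below [hd s], for a sequence [s] of length [k], the
   theories being compared with those of the tail of [s]. *)
Fixpoint reflective k s a : Prop :=
  if k is k'.+1 then
    [/\ a ∈ hd s, elem_un (reflective k' (take k' s)) (V a) (V (hd s)) &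
      forall phi x, V a x ->
        (sat_un (@elem U) (V (hd s)) (reflective k' (take k' s)) phi (env2 a x) <->
         sat_un (@elem U) (V (head kappa (behead s))) (reflective k' (behead s)) phi
           (env2 (hd s) x))]
  else regular_uncountable a.

(* A sequence [l] is read as [x :: a :: s]. *)
Definition level_types (i : nat * form_un 2) l : Prop :=
  let s := behead (behead l) in
  sat_un (@elem U) (V (head kappa s)) (reflective i.1 s) i.2 (env2 (hd (behead l)) (hd l)).

Hypotheses (n_gt0 : 0 < n) (lk : limit kappa) (il : inaccessible lambda).
Hypotheses (lambda_kappa : lambda ∈ kappa) (sb : size b = n) (hdb : hd b = lambda).
Hypothesis lambda_elem : elementary_substructure (V lambda) (V kappa).
Hypothesis lambda_elem_un : elem_un (@regular_uncountable U) (V lambda) (V kappa).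
Hypothesis lambda_ineffable : 1 < n -> ineffable n.-1 lambda.
Hypothesis lambda_indescribable : forall phi, indescribable kappa phi lambda.
Hypothesis sth : stationary lambda h.
Hypothesis htypes : forall a, a ∈ h -> limit a /\ same_type level_types n a (a :: b) b.

Let ok : ordinal kappa. Proof. by case: lk. Qed.
Let ll : limit lambda. Proof. by case: il. Qed.
Let ol : ordinal lambda. Proof. by case: ll. Qed.

Definition reflective_at k a : Prop := reflective k (take k b) a.
Local Notation Rk := reflective_at.

(** The theory of [lambda] in the level at the second entry of [b], or in V_kappa when [k = 0]: the
    target theory in the definition of [k.+1]-reflectiveness. *)
Definition theory_at k (phi : form_un 2) x : Prop :=
  sat_un (@elem U) (V (head kappa (take k (behead b)))) (reflective k (take k (behead b))) phi
    (env2 lambda x).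

Lemma b_cons : b = lambda :: behead b.
Proof. by rewrite -hdb; case: (b) sb n_gt0 => [<-|]. Qed.

Lemma reflective_atS k a : k < n -> Rk k.+1 a <->
  [/\ a ∈ lambda, elem_un (Rk k) (V a) (V lambda) &
   forall phi x, V a x ->
     (sat_un (@elem U) (V lambda) (Rk k) phi (env2 a x) <-> theory_at k phi x)].
Proof.
move=> kn; rewrite /Rk /=.
have -> : hd (take k.+1 b) = lambda by rewrite b_cons.
have -> : behead (take k.+1 b) = take k (behead b) by rewrite b_cons.
by rewrite take_takel.
Qed.

(** For positive [k] both levels coincide; for [k = 0] the default [kappa] of [head] replaces
    [lambda], and elementarity with the predicate of level 0 is used. *)
Lemma sat_lambda k phi a x : k < n -> V lambda a -> V lambda x ->
  sat_un (@elem U) (V lambda) (Rk k) phi (env2 a x) <->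
  sat_un (@elem U) (V (head kappa (take k b))) (Rk k) phi (env2 a x).
Proof.
case: k => [|k] kn la lx; last by rewrite b_cons.
by rewrite take0; apply: lambda_elem_un; apply: V_env2.
Qed.

(** Types of length [k.+1] for the key [(k, phi)] agree, with [x] as parameter: dropping [x] and the
    first ordinal leaves the sequence that defines level [k]. *)
Lemma stationary_theory k phi a x : k < n -> a ∈ h -> V a x ->
  sat_un (@elem U) (V lambda) (Rk k) phi (env2 a x) <-> theory_at k phi x.
Proof.
move=> kn ah ax; have [la ta] := htypes ah; have [hl _] := sth; have al := hl _ ah.
have oa := ord_elem ol al.
rewrite sat_lambda //; [|exact/(V_ord ol oa)|exact: V_lt ax].
have := ta (k, phi) k.+1 [:: x] kn; rewrite /level_types /=.
have -> : take k.+1 b = lambda :: take k (behead b) by rewrite b_cons.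
by apply=> y [<-|].
Qed.

Lemma V_empty a : (exists z, z ∈ a) -> V a emptyset.
Proof. by case=> z za; exists z => // y /in_emptyset. Qed.

(** Equality of types gives the condition on theories for all members of [h]; the elementarity
    conditions hold at common closure points of countably many functions. *)
Lemma reflective_points : exists F, closed_under F lambda /\
  forall a, a ∈ h -> limit a -> closed_under F a -> forall k, k <= n -> Rk k a.
Proof.
have ex k : exists F, closed_under F lambda /\ forall a, a ∈ lambda -> limit a ->
    closed_under F a -> elem_un (Rk k) (V a) (V lambda).
  by apply: (elementary_club (codeP := fun _ : unit => 0) (codeQ := of_void nat)) => // -[] [].
have [F hF] := ClassicalEpsilon.choice (fun k F => closed_under F lambda /\
  forall a, a ∈ lambda -> limit a -> closed_under F a -> elem_un (Rk k) (V a) (V lambda)) ex.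
have [|G [Gl hG]] := closed_under_all il (F := F); first by move=> k; case: (hF k).
exists G; split=> // a ah la Ga; have [hl _] := sth; have al := hl _ ah.
have Vae : V a emptyset by apply: V_empty; exists emptyset; exact: limit0.
case=> [|k] kn; last first.
  apply/reflective_atS => //; split=> //; first by have [_] := hF k; apply => //; exact: hG.
  by move=> phi x ax; apply: stationary_theory.
(* At level 0, the formula [Un tt ord0] puts [a] into the predicate because it puts the inaccessible
   [lambda] there. *)
have := stationary_theory (Un tt ord0) n_gt0 ah Vae.
rewrite /sat_un /theory_at /= take0 /sat_un /= /env2 !scons0 => e; apply/e.
by split; [exact: inaccessible_regular|exact: inaccessible_uncountable].
Qed.

Lemma reflective_at_ord k a : k <= n -> Rk k a -> ordinal a.
Proof.
case: k => [|k] kn; first by case=> -[[oa _] _ _].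
by case/(reflective_atS _ kn) => /(ord_elem ol).
Qed.

Lemma ex_reflective : exists a, [/\ a ∈ h, limit a & forall k, k <= n -> Rk k a].
Proof.
have [F [Fl hF]] := reflective_points.
have [a [ah al la Fa]] := stationary_closure_point il sth Fl.
by exists a; split=> //; exact: hF.
Qed.

Lemma reflective_at_nonempty k a : k < n -> Rk k.+1 a -> exists z, z ∈ a.
Proof.
move=> kn /(reflective_atS _ kn)[_ el _].
have [_ h'] := el 0 (Ex (Equ ord0 ord0)) (fun i => emptyset) ltac:(by case).
have [|x [[z za _] _]] := h'; last by exists z.
by exists emptyset; split=> //; exact: (V_num ll 0).
Qed.

(** Every [k.+1]-reflective ordinal has the theory [theory_at k], as do the members of [h]. Some
    member of [h] is [k]-reflective, which the formula [Un tt ord0] of this theory expresses. *)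
Lemma reflective_at_pred k a : k < n -> Rk k.+1 a -> Rk k a.
Proof.
move=> kn Ra; have Vae := V_empty (reflective_at_nonempty kn Ra).
have [_ _ ha] := (reflective_atS a kn).1 Ra.
have [c [ch lc hc]] := ex_reflective.
have Vce : V c emptyset by apply: V_empty; exists emptyset; exact: limit0.
have := ha (Un tt ord0) emptyset Vae.
have := stationary_theory (Un tt ord0) kn ch Vce.
rewrite /sat_un /= /env2 !scons0 => <- e; apply/e; apply: hc; exact: ltnW.
Qed.

Lemma reflective_at_le j k a : j <= k -> k <= n -> Rk k a -> Rk j a.
Proof.
move=> jk; rewrite -(subnKC jk); elim: (k - j) => [|m ih]; rewrite ?addn0 // addnS => mn.
by move/(reflective_at_pred mn)/(ih (ltnW mn)).
Qed.

Definition reflective_rel y a : Prop := exists k, [/\ k <= n, y = num k, a ∈ lambda & Rk k a].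
Local Notation R := reflective_rel.

Lemma levelE k a : level R k a <-> [/\ k <= n, a ∈ lambda & Rk k a].
Proof.
split; first by move=> [y [/numeralP -> [j [jn /num_inj -> al Ra]]]].
by move=> [kn al Ra]; exists (num k); split; [apply/numeralP|exists k].
Qed.

Lemma sat_level k c m (phi : form_un m) e : k <= n -> ole c lambda -> (forall i, V c (e i)) ->
  sat_un (@elem U) (V c) (level R k) phi e <-> sat_un (@elem U) (V c) (Rk k) phi e.
Proof.
move=> kn cl ec; apply: sat_ext => // _ x cx; rewrite levelE; split=> [[]//|Rx].
split=> //; apply/(V_ord ol (reflective_at_ord kn Rx)); exact: V_le cx.
Qed.

(** The levels at the two larger ordinals [c] and [d] are elementary in V_lambda with the predicate
    [Rk k], so the compared theories can be read there, and the theory of [c] is [theory_at k]. *)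
Lemma reflective_B7 : B7 lambda R n.
Proof.
move=> k a c d kn oa oc od Vd ne ac cd lc ldd.
have [kn1 cl Rc] := (levelE _ _).1 lc; have [_ dl Rd] := (levelE _ _).1 ldd.
have [_ elc tc] := (reflective_atS c kn).1 Rc; have [_ eld _] := (reflective_atS d kn).1 Rd.
have al := ord_trans ol cl ac.
have [Vca Vdc] : V c a /\ V d c by split; apply/V_ord.
have Vae := V_empty ne.
have satc phi x : V a x -> sat_un (@elem U) (V c) (level R k) phi (env2 a x) <->
    sat_un (@elem U) (V lambda) (Rk k) phi (env2 a x).
  move=> ax; have eV : forall i, V c (env2 a x i) by apply: V_env2 => //; exact: V_lt ax.
  by rewrite sat_level; [exact: elc|exact: ltnW|left|].
have satd phi x : V a x -> sat_un (@elem U) (V d) (level R k) phi (env2 c x) <->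
    sat_un (@elem U) (V lambda) (Rk k) phi (env2 c x).
  move=> ax; have eV : forall i, V d (env2 c x i).
    by apply: V_env2 => //; apply: (V_lt _ cd) => //; exact: V_lt ax.
  by rewrite sat_level; [exact: eld|exact: ltnW|left|].
split.
  move=> /levelE[_ _ Ra]; have [_ _ ta] := (reflective_atS a kn).1 Ra.
  by move=> phi s ax; rewrite satc // satd // ta // tc //; exact: V_lt ax.
move=> hyp.
have agree phi x : V a x -> sat_un (@elem U) (V lambda) (Rk k) phi (env2 a x) <->
    sat_un (@elem U) (V lambda) (Rk k) phi (env2 c x).
  by move=> ax; rewrite -satc // -satd //; exact: hyp.
apply/levelE; split=> //; apply/reflective_atS => //; split=> //; last first.
  by move=> phi x ax; rewrite agree // tc //; exact: V_lt ax.
move=> m psi.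
(* The elementarity of V_a follows from that of V_c: reflecting [psi] is itself expressed by a
   formula about the ordinal. *)
have [phi hphi] := dfn_reflects (fun _ : unit => Rk k) (@of_void (U -> U -> Prop)) ll psi (m := 2) ord0.
have la : V lambda a by apply/(V_ord ol oa).
have lcV : V lambda c by apply/(V_ord ol oc).
have le : V lambda emptyset by exact: (V_num ll 0).
have := hphi _ (V_env2 la le); have := hphi _ (V_env2 lcV le).
have E0 x y : env2 x y ord0 = x by rewrite /env2 scons0.
rewrite !E0 => ec ea; have e := agree phi _ Vae.
by apply/ea/e/ec => f; exact: elc.
Qed.

(** Level 1 suffices: it compares [a] in V_lambda with [lambda] in V_kappa, and [sat_lambda] lifts
    the former to V_kappa. *)
Lemma reflective_transfer (D : U -> Prop) a : Rk n a ->
  (forall m (i : 'I_m), dfn kappa (fun _ : unit => @regular_uncountable U)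
     (@of_void (U -> U -> Prop)) (fun e => D (e i))) ->
  D a <-> D lambda.
Proof.
move=> /(reflective_at_le n_gt0 (leqnn n)) R1 /(_ 2 ord0)[phi hphi].
have Vae := V_empty (reflective_at_nonempty n_gt0 R1).
have [al _ /(_ phi _ Vae)] := (reflective_atS a n_gt0).1 R1.
have oa := ord_elem ol al.
have la : V lambda a by apply/(V_ord ol oa).
have [le ke] : V lambda emptyset /\ V kappa emptyset by split; [exact: (V_num ll 0)|exact: (V_num lk 0)].
rewrite sat_lambda // take0 /theory_at take0 /=.
have kV x : x ∈ kappa -> V kappa x by move=> xk; apply/V_ord => //; exact: ord_elem xk.
have := hphi _ (V_env2 (kV _ lambda_kappa) ke).
have := hphi _ (V_env2 (kV _ (ord_trans ok lambda_kappa al)) ke).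
by rewrite /sat_un /env2 !scons0 => -> ->.
Qed.

Theorem reflective_model : exists R : U -> U -> Prop,
  [/\ forall y z, R y z -> V lambda y /\ V lambda z, reflective_axioms lambda R n &
    forall a, level R n a -> (1 < n -> ineffable n.-1 a) /\ fully_indescribable lambda a].
Proof.
have RV y z : R y z -> V lambda y /\ V lambda z.
  move=> [k [kn -> zl _]]; split; first exact: V_num.
  by apply/V_ord => //; exact: ord_elem zl.
exists R; split=> //; [split; split|].
- exact: inaccessible_zfc.
- move=> x lx; exists (sep x (fun w => exists y z, [/\ V lambda y, V lambda z, is_pair w y z & R y z])).
  split; last by move=> w _; exact: in_sep.
  by apply: V_subset lx _ => z /in_sep[].
- move=> y z _ _ [k [kn -> zl Rz]]; split; [exact: ord_num| |exact: ord_elem zl].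
  by exists k; split=> //; apply/numeralP.
- move=> x lx; rewrite levelE; split; first by case.
  move=> Rx; split=> //; apply/(V_ord ol _) => //.
  by case: Rx => -[[]].
- move=> k a kn _ /levelE[_ al Ra]; apply/levelE; split=> //; first exact: ltnW.
  exact: reflective_at_pred.
(* No numeral is a limit: 0 is empty and a successor has a greatest element. *)
- move=> k y a _ /numeralP -> [_ [c ck] hk]; exfalso.
  case: k ck hk => [/in_emptyset//|k] _ /(_ _ (in_ssucc_self _))[d [/in_ssucc[dk kd|->]]].
    exact: elem_asym dk kd.
  exact: elem_irr.
- exact: reflective_B7.
- move=> m.
  have [F [Fl hF]] := elementary_club (codeP := of_void nat) (codeQ := fun _ : unit => 0)
    ltac:(by case) ltac:(by case=> [[]]) (@of_void (U -> Prop)) (fun=> R) il.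
  have [G [Gl hG]] := reflective_points.
  (* For B8, a closure point [a] of [H] in [h] is reflective at every level up to [n], and V_a is
     elementary in V_lambda with [R]. *)
  have [H [Hl hH]] := closed_under2 il Fl Gl.
  have [a [ah al la Ha]] := stationary_closure_point il sth Hl.
  have [Fa Ga] := hH a al la Ha.
  have Ra := hG a ah la Ga.
  exists a; split.
  + by apply/V_ord => //; exact: ord_elem al.
  + by have [[]] := Ra 0 isT.
  + by apply/levelE; split=> //; exact: Ra.
  + by move=> phi _ s sa; exact: hF.
move=> a /levelE[_ al Ra]; have oa := ord_elem ol al; split.
  move=> n1; apply/(reflective_transfer Ra); last exact: lambda_ineffable.
  by move=> m i; apply: dfn_ineffable => //; case: (n) n1 => // -[].
split=> //.
  by have [[]] := reflective_at_le (leq0n n) (leqnn n) Ra.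
have Va : V lambda a by apply/V_ord.
have [sub el] := lambda_elem.
move=> phi A Aa; have VA : V lambda A by apply: V_subset Va Aa.
rewrite el => [sA|]; last exact: V_env2.
have ia : indescribable kappa phi a.
  apply/(reflective_transfer Ra); last exact: lambda_indescribable.
  by move=> m i; exact: dfn_indescribable.
have [nu [B [nua hB sB]]] := ia A Aa sA; exists nu, B; split=> //.
rewrite el //; apply: V_env2; first by apply: V_trans Va nua.
by apply: V_subset VA _ => z /hB[].
Qed.

End Reflective.

(** * Indescribability and ineffability *)

Section Counterexamples.
Variables (U : universe) (n : nat) (kappa lambda : U) (b : seq U) (h : U).
Implicit Types (x y z a c : U) (s t p : seq U).

Definition describing phi a A : Prop := [/\ subset A a,
  sat_set (@elem U) (V kappa) phi (env2 a A) &
  ~ exists nu B, [/\ nu ∈ a, forall z, z ∈ B <-> z ∈ A /\ z ∈ nu &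
      sat_set (@elem U) (V kappa) phi (env2 nu B)]].

(** The counterexample is selected by [epsilon] once and for all, so that equality of types makes
    those selected at [a] and at [lambda] agree below [a]. *)
Definition describing_types phi s : Prop :=
  hd s ∈ epsilon (inhabits emptyset) (describing phi (hd (behead s))).

Definition non_homogeneous a (f : U -> U) : Prop := regressive n.-1 a f /\
  ~ exists h, stationary a h /\ homogeneous n.-1 f h.

(* A sequence of length [n.+1] is read as [z :: rcons xs a], with [xs] of length [n.-1]. *)
Definition regressive_types (_ : unit) s : Prop :=
  hd s ∈ epsilon (inhabits id) (non_homogeneous (nth emptyset s n))
    (set_of (take n.-1 (behead s))).

Hypotheses (n_gt0 : 0 < n) (lk : limit kappa) (il : inaccessible lambda).
Hypotheses (lambda_kappa : lambda ∈ kappa) (sb : size b = n) (hdb : hd b = lambda).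
Hypothesis sth : stationary lambda h.

Let ol : ordinal lambda. Proof. by case: il => [[]]. Qed.

Lemma not_indescribable phi a : ~ indescribable kappa phi a -> exists A, describing phi a A.
Proof.
move=> na; apply: NNPP => nA; apply: na => A Aa sA; apply: NNPP => nB; apply: nA.
by exists A.
Qed.

Lemma take1_b : take 1 b = [:: lambda].
Proof. by move: hdb n_gt0; rewrite -sb; case: (b) => //= x s ->; rewrite take0. Qed.

(** A failure at [lambda] passes to any [a] in [h], and the counterexample selected at [a] is the
    restriction to [a] of the one selected at [lambda]. The latter is thus reflected at [a] after
    all. *)
Lemma types_indescribable :
  (forall a, a ∈ h -> same_type (set_types kappa) n a (a :: b) b) ->
  (forall a, a ∈ h -> same_type describing_types n a (a :: b) b) ->
  forall phi, indescribable kappa phi lambda.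
Proof.
move=> hset hdes phi; apply: NNPP => nl.
have [_ _] := epsilon_spec (inhabits emptyset) _ (not_indescribable nl); apply.
have [a [ah al la _]] := stationary_closure_point il sth (F := id) (fun a al => al).
have ak : a ∈ kappa by case: lk => ok _ _; apply: ord_trans al.
have na : ~ indescribable kappa phi a.
  move=> ia; apply: nl.
  apply: (proj1 (same_type_transfer n_gt0 lk lambda_kappa sb hdb (hset a ah) ak _)) ia.
  by move=> m i; exact: dfn_indescribable.
have [Aa sA _] := epsilon_spec (inhabits emptyset) _ (not_indescribable na).
set A := epsilon _ _ in Aa sA.
exists a, A; split=> // z.
have E : z ∈ a -> (z ∈ A <-> z ∈ epsilon (inhabits emptyset) (describing phi lambda)).
  move=> za; have := hdes a ah phi 1 [:: z] n_gt0; rewrite take1_b /describing_types /=.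
  apply=> y [<-|//]; have oa := ord_elem ol al.
  by apply/(V_ord oa (ord_elem oa za)).
split=> [zA|[zL za]]; last exact/E.
by have za := Aa z zA; split=> //; apply/E.
Qed.

(** The set [h] itself is homogeneous for the selected counterexample: [n.-1] increasing members of
    [h] followed by [lambda] have the type of [b], so that membership of a small [z] in the value of
    [f] does not depend on them. *)
Lemma types_ineffable :
  (forall a, a ∈ h -> same_type regressive_types n a (a :: b) b) ->
  1 < n -> ineffable n.-1 lambda.
Proof.
move=> hreg n1; have n1' : 0 < n.-1 by case: (n) n1 => // -[].
split=> //; apply: NNPP => nl.
have ex : exists f, non_homogeneous lambda f.
  apply: NNPP => nf; apply: nl => f rf; apply: NNPP => nh; apply: nf.
  by exists f.
have [_] := epsilon_spec (inhabits id) _ ex; apply; exists h; split=> //.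
set f := epsilon _ _; have [hl _] := sth.
have key x z : tuples n.-1 h x -> (forall a, a ∈ x -> z ∈ a) ->
    (z ∈ f x <-> regressive_types tt (z :: take n b)).
  move=> [xh sx] zx.
  have [|xs [ixs sxs hxs]] := has_size_increasing _ sx; first by move=> a /xh/hl/(ord_elem ol).
  have -> : x = set_of xs by apply: set_ext => w; rewrite in_set_of hxs.
  case: xs sxs ixs hxs => [e|a xs sxs ixs hxs]; first by move: n1'; rewrite -e.
  have ah : a ∈ h by apply/xh/hxs; left.
  have ty : same_type regressive_types n a ((a :: xs) ++ b) b.
    apply: (same_type_cat (X := fun a => a ∈ h)) => // [y /hl/(ord_elem ol)//|y /hxs/xh//].
  rewrite -(ty tt n [:: z] (leqnn n)); last first.
    move=> y [<-|//]; have oa := ord_elem ol (hl _ ah).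
    have za : z ∈ a by apply/zx/hxs; left.
    by apply/(V_ord oa (ord_elem oa za)).
  have -> : take n (a :: xs ++ b) = rcons (a :: xs) lambda.
    rewrite -cat_cons take_cat sxs ltnNge leq_pred /=.
    by rewrite -[X in X - _](prednK n_gt0) subSnn take1_b cats1.
  move: (a :: xs) sxs => L sL.
  have -> : regressive_types tt ([:: z] ++ rcons L lambda) <->
      z ∈ epsilon (inhabits id) (non_homogeneous lambda) (set_of L) by
    rewrite /regressive_types /= -[n in nth _ _ n](prednK n_gt0) /= -sL nth_rcons ltnn eqxx
      -cats1 take_size_cat.
  by [].
move=> x y c tx ty [_ mc] z zc.
have lt w a : tuples n.-1 h w -> (forall a, a ∈ w -> a ∈ x \/ a ∈ y) -> a ∈ w -> z ∈ a.
  move=> [wh _] hw aw; apply: ole_subset (mc a (hw a aw)) _ zc.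
  by apply: ord_elem ol _; apply/hl/wh.
rewrite !key //; first by move=> a; apply: (lt y) => // a' ?; right.
by move=> a; apply: (lt x) => // a' ?; left.
Qed.

End Counterexamples.

(** * The countable family of relations and the final assembly *)

Definition type_index : Type :=
  (({m & form_set m} + nat * form_un 2) + (form_set 2 + unit))%type.

Definition type_family (U : universe) n (kappa : U) (i : type_index) : seq U -> Prop :=
  match i with
  | inl (inl phi) => set_types kappa phi
  | inl (inr i) => level_types kappa i
  | inr (inl phi) => describing_types kappa phi
  | inr (inr u) => regressive_types n u
  end.

Lemma ex_form_code P Q (codeP : P -> nat) (codeQ : Q -> nat) m :
  injective codeP -> injective codeQ -> exists code : form P Q m -> nat, injective code.
Proof.
move=> iP iQ; exists (fun phi => form_code codeP codeQ (existT _ m phi)) => phi psi.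
move=> /(form_code_inj iP iQ) e.
exact: (Eqdep_dec.inj_pair2_eq_dec _ (fun x y => decP (x =P y :> nat)) _ _ _ _ e).
Qed.

Lemma ex_type_code : exists code : type_index -> nat, injective code.
Proof.
have void_inj : injective (of_void nat) by case.
have unit_inj : injective (fun _ : unit => 0) by case=> [[]].
have [cs cs_inj] := ex_form_code 2 void_inj void_inj.
have [cu cu_inj] := ex_form_code 2 unit_inj void_inj.
have [c c_inj] : exists c : {m & form_set m} -> nat, injective c.
  by exists (form_code (of_void nat) (of_void nat)); exact: form_code_inj.
exists (fun i => pickle (match i with
  | inl (inl phi) => inl (inl (c phi))
  | inl (inr (k, phi)) => inl (inr (k, cu phi))
  | inr (inl phi) => inr (inl (cs phi))
  | inr (inr u) => inr (inr u)
  end : (nat + nat * nat + (nat + unit))%type)).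
move=> i j /(pcan_inj (@pickleK _)).
case: i j => [[phi|[k phi]]|[phi|[]]] [[psi|[m psi]]|[psi|[]]] //.
- by case=> /c_inj ->.
- by case=> -> /cu_inj ->.
- by case=> /cs_inj ->.
Qed.

Theorem theorem8 (U : universe) (n : nat) (kappa : U) :
  1 <= n -> cardinal kappa -> subtle n kappa ->
  exists lambda : U,
    [/\ regular lambda,
        elementary_substructure (V lambda) (V kappa),
        exists R : U -> Prop,
          [/\ forall a, R a -> a ∈ lambda,
              weakly_reflective_axioms lambda R n &
              forall a, R a ->
                (1 < n -> ineffable n.-1 a) /\ fully_indescribable lambda a] &
        exists R : U -> U -> Prop,
          [/\ forall y z, R y z -> V lambda y /\ V lambda z,
              reflective_axioms lambda R n &
              forall a, level R n a ->
                (1 < n -> ineffable n.-1 a) /\ fully_indescribable lambda a]].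
Proof.
move=> n_gt0 card_kappa subtle_kappa.
have ik : inaccessible kappa by exact: (subtle_inaccessible n_gt0 card_kappa subtle_kappa).
have [lk _ _] := ik; have [ok _ _] := lk.
have [F [Fk hF]] := elementary_club (codeP := of_void nat) (codeQ := of_void nat)
  ltac:(by case) ltac:(by case) (@of_void (U -> Prop)) (@of_void (U -> U -> Prop)) ik.
have [G [Gk hG]] := regular_uncountable_elementary_club ik.
have [H [Hk hH]] := closed_under2 ik Fk Gk.
have [code code_inj] := ex_type_code.
have [b [h [sb _ bk [il sth] htypes]]] :=
  stationary_types n_gt0 card_kappa subtle_kappa (type_family n kappa) code_inj Hk.
set lambda := hd b in il sth.
(* As an entry of [b], [lambda] is itself a closure point of [H], so that V_lambda is elementary in
   V_kappa for both languages. *)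
have [lambda_kappa ll Hl] : [/\ lambda ∈ kappa, limit lambda & closed_under H lambda].
  by apply: bk; rewrite /lambda; case: (b) sb n_gt0 => [<-|x s _ _] //; left.
have [Fl Gl] := hH _ lambda_kappa ll Hl.
have el : elementary_substructure (V lambda) (V kappa).
  by split=> [x|]; [exact: V_lt|exact: hF].
have hset a : a ∈ h -> same_type (set_types kappa) n a (a :: b) b.
  by case/htypes=> _ _ ty phi; exact: (ty (inl (inl phi))).
have hlev a : a ∈ h -> limit a /\ same_type (level_types kappa) n a (a :: b) b.
  by case/htypes=> la _ ty; split=> // i; exact: (ty (inl (inr i))).
have hdes a : a ∈ h -> same_type (describing_types kappa) n a (a :: b) b.
  by case/htypes=> _ _ ty phi; exact: (ty (inr (inl phi))).
have hreg a : a ∈ h -> same_type (regressive_types n (U := U)) n a (a :: b) b.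
  by case/htypes=> _ _ ty u; exact: (ty (inr (inr u))).
have ind := types_indescribable n_gt0 lk il lambda_kappa sb erefl sth hset hdes.
have inef := types_ineffable n_gt0 il sb erefl sth hreg.
exists lambda; split.
- exact: inaccessible_regular.
- exact: el.
- exact: (weakly_reflective_model n_gt0 lk il lambda_kappa sb erefl el inef ind sth hset).
- exact: (reflective_model n_gt0 lk il lambda_kappa sb erefl el (hG _ lambda_kappa ll Gl) inef ind sth hlev).
Qed.
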